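(* Let $P(x,\partial)\in W[x]$ have a regular singular point at $x=\infty$ (with arbitrary singularities at any other points) and semi-simple exponents $$\{[\mu_1]_{n_1},\dots,[\mu_l]_{n_l}\}$$ at $x=\infty$, where $\sum_{i=1}^ln_i=n=\mathrm{ord}\,P$, $\mu_i\notin\mathbb Z$ for all $i$, and $\mu_i-\mu_j\notin\mathbb Z$ if $i\ne j$. Then for each $i$, $$\mathrm{ord}\,E(0,\mu_i-1)P(x,\partial)<\mathrm{ord}\,P$$ if and only if $$\deg P-\mathrm{ord}\,P<n_i.$$
   Context: $W[x]$ is the Weyl algebra generated over $\mathbb C$ by $x$ and $\partial=\frac{d}{dx}$ with $\partial x-x\partial=1$, and $W(x)=\mathbb C(x)\otimes_{\mathbb C[x]}W[x]$ is its localization. For $P=\sum_ip_i(x)\partial^i$, $\mathrm{ord}\,P$ is the largest $i$ with $p_i\neq0$, and for $P\in W[x]$, $\deg P$ is the maximum of the degrees of the polynomials $p_i$. $\mathrm RP$ (the reduced representative of $P\ne0$) is an element of minimal degree of $\mathbb C(x)P\cap W[x]$. $\mathcal L$ is the algebra automorphism of $W[x]$ with $x\mapsto-\partial$, $\partial\mapsto x$. For $c,\lambda\in\mathbb C$, $\mathrm{Ad}((x-c)^\lambda)$ is the automorphism of $W(x)$ with $x\mapsto x$, $\partial\mapsto\partial-\frac{\lambda}{x-c}$, and $\mathrm{RAd}((x-c)^\lambda)=\mathrm R\circ\mathrm{Ad}((x-c)^\lambda)$. The Euler transform is $E(0,\lambda)=\mathcal L\circ\mathrm{RAd}(x^{-\lambda})\circ\mathcal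 L^{-1}\circ\mathrm R$. Semi-simple exponents at $\infty$: write $[\mu]_m=\{\mu,\mu+1,\dots,\mu+m-1\}$. Write $P=\sum_{s\ge0}x^{\rho-s}P_s(\partial)$ with polynomials $P_s$, put $(\lambda)_0=1$, $(\lambda)_k=\lambda(\lambda+1)\cdots(\lambda+k-1)$ and $p_k(\lambda,x)=\sum_{i=0}^k(\lambda+i+1)_{k-i}\frac1{(k-i)!}P_i^{(k-i)}(x)$. $P$ has semi-simple exponents $\{[\mu_1]_{m_1},\dots,[\mu_l]_{m_l}\}$ at $\infty$ (with $\mu_i-\mu_j\notin\mathbb Z$ for $i\ne j$, $m=\sum m_i$) if $P_i^{(j)}(0)=0$ for $i+j<m$, $P_0^{(m)}(0)\ne0$, and $p_k(-\mu_i-j-k,0)=0$ for $1\le i\le l$, $0\le j\le m_i-1$, $m\le k\le m+m_i-j-1$.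
   Formalization: In the criterion, deg P is replaced by the degree of the reduced representative RP (equal to deg P when P is reduced); with deg P itself the ''only if'' fails, e.g. for P = x²(x∂+μ), where E(0,μ−1)P has order 0 but deg P − ord P = 2. *)

(* Defs.v *)
From HB Require Import structures.
From mathcomp Require Import all_boot all_order all_algebra.
From mathcomp Require Import ring.
From mathcomp Require Import boolp classical_sets reals complex.

Set Implicit Arguments.
Unset Strict Implicit.
Unset Printing Implicit Defensive.

Import GRing.Theory.
Import generic_quotient.
Local Open Scope ring_scope.
Local Open Scope quotient_scope.

HB.mixin Record isDifferential A of GRing.ComNzRing A := {
  der : A -> A;
  derD : {morph der : a b / a + b};
  derM : forall a b, der (a * b) = der a * b + a * der b
}.

#[short(type="diffRingType")]
HB.structure Definition Differential :=
  {A of GRing.ComNzRing A & isDifferential A}.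

Lemma der0 (A : diffRingType) : der (0 : A) = 0.
Proof. by apply: (@addrI _ (der 0)); rewrite -derD !addr0. Qed.

Lemma der1 (A : diffRingType) : der (1 : A) = 0.
Proof.
apply: (@addrI _ (der 1)); rewrite addr0.
by have := derM (1 : A) 1; rewrite !mulr1 mul1r => {3}->.
Qed.

(* [diffop A] is the ring of differential operators $\sum_i a_i \partial^i$,
   coefficients on the left, stored as the polynomial with coefficients [a_i];
   only its additive structure is that of [{poly A}]. *)
Definition diffop (A : diffRingType) : Type := {poly A}.
HB.instance Definition _ (A : diffRingType) := GRing.Zmodule.on (diffop A).

Section DiffopRing.
Variable A : diffRingType.
Implicit Types (a b : A) (P Q S : {poly A}).

(* d (\sum_j q_j d^j) = \sum_j (q_j' d^j + q_j d^(j+1)) *)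
Definition diffop_lmulD (Q : {poly A}) : {poly A} :=
  map_poly der Q + Q * 'X.

Definition diffop_mul (P Q : {poly A}) : {poly A} :=
  \sum_(i < size P) P`_i *: iter i diffop_lmulD Q.

Lemma coef_lmulD Q i :
  (diffop_lmulD Q)`_i = der Q`_i + (if i == 0%N then 0 else Q`_i.-1).
Proof. by rewrite coefD coef_map_id0 ?der0 // coefMX. Qed.

Lemma lmulDD P Q : diffop_lmulD (P + Q) = diffop_lmulD P + diffop_lmulD Q.
Proof.
apply/polyP => i; rewrite coefD !coef_lmulD !coefD derD.
by case: eqP => _; rewrite ?addr0 // addrACA.
Qed.

Lemma lmulD0 : diffop_lmulD 0 = 0.
Proof. by apply: (@addrI _ (diffop_lmulD 0)); rewrite -lmulDD !addr0. Qed.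

Lemma lmulDZ a Q :
  diffop_lmulD (a *: Q) = der a *: Q + a *: diffop_lmulD Q.
Proof.
apply/polyP => i; rewrite coef_lmulD [RHS]coefD !coefZ coef_lmulD derM mulrDr addrA.
by case: eqP => _; rewrite ?mulr0.
Qed.

Lemma iter_lmulDD n P Q :
  iter n diffop_lmulD (P + Q) = iter n diffop_lmulD P + iter n diffop_lmulD Q.
Proof. by elim: n => //= n ->; rewrite lmulDD. Qed.

Lemma iter_lmulD0 n : iter n diffop_lmulD 0 = 0.
Proof. by elim: n => //= n ->; rewrite lmulD0. Qed.

Lemma diffop_mulE n P Q : (size P <= n)%N ->
  diffop_mul P Q = \sum_(i < n) P`_i *: iter i diffop_lmulD Q.
Proof.
move=> le_n; rewrite /diffop_mul (big_ord_widen n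
  (fun i => P`_i *: iter i diffop_lmulD Q)) // big_mkcond /=.
apply: eq_bigr => i _; case: ltnP => // le_i.
by rewrite nth_default ?scale0r.
Qed.

Lemma diffop_mulDl P Q S :
  diffop_mul (P + Q) S = diffop_mul P S + diffop_mul Q S.
Proof.
pose n := maxn (size P) (size Q).
rewrite !(@diffop_mulE n) ?leq_maxl ?leq_maxr //; last exact: size_polyD.
by rewrite -big_split; apply: eq_bigr => i _; rewrite coefD scalerDl.
Qed.

Lemma diffop_mulDr P Q S :
  diffop_mul P (Q + S) = diffop_mul P Q + diffop_mul P S.
Proof.
rewrite -big_split; apply: eq_bigr => i _.
by rewrite iter_lmulDD scalerDr.
Qed.

Lemma diffop_mul0l Q : diffop_mul 0 Q = 0.
Proof. by rewrite /diffop_mul size_poly0 big_ord0. Qed.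

Lemma diffop_mul0r P : diffop_mul P 0 = 0.
Proof. by rewrite /diffop_mul big1 // => i _; rewrite iter_lmulD0 scaler0. Qed.

Lemma diffop_mulZl a P Q : diffop_mul (a *: P) Q = a *: diffop_mul P Q.
Proof.
rewrite !(@diffop_mulE (size P)) ?size_scale_leq // scaler_sumr.
by apply: eq_bigr => i _; rewrite coefZ scalerA.
Qed.

Lemma diffop_mul1l Q : diffop_mul 1 Q = Q.
Proof. by rewrite /diffop_mul size_poly1 big_ord1 coef1 scale1r. Qed.

Lemma iter_lmulD1 n : iter n diffop_lmulD 1 = 'X^n.
Proof.
elim: n => [|n]; rewrite ?expr0 //= => ->.
apply/polyP => i; rewrite coef_lmulD !coefXn.
have -> : der ((i == n)%:R : A) = 0 by case: (i == n); rewrite ?der0 ?der1.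
by rewrite add0r; case: i => [|i].
Qed.

Lemma diffop_mul1r P : diffop_mul P 1 = P.
Proof.
rewrite -[RHS]coefK poly_def; apply: eq_bigr => i _.
by rewrite iter_lmulD1.
Qed.

Lemma diffop_mul_suml (n : nat) (F : 'I_n -> {poly A}) Q :
  diffop_mul (\sum_(i < n) F i) Q = \sum_(i < n) diffop_mul (F i) Q.
Proof.
apply: (big_morph (fun P => diffop_mul P Q)) => [P P'|].
  exact: diffop_mulDl.
exact: diffop_mul0l.
Qed.

Lemma lmulD_sum (n : nat) (F : 'I_n -> {poly A}) :
  diffop_lmulD (\sum_(i < n) F i) = \sum_(i < n) diffop_lmulD (F i).
Proof. by apply: (big_morph _ lmulDD lmulD0). Qed.

Lemma lmulD_mul P Q :
  diffop_lmulD (diffop_mul P Q) = diffop_mul (diffop_lmulD P) Q.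
Proof.
pose n := size P.
have mulX : diffop_mul (P * 'X) Q =
    \sum_(i < n) P`_i *: iter i.+1 diffop_lmulD Q.
  rewrite (@diffop_mulE n.+1) ?(leq_trans (size_polyMleq _ _)) //; last first.
    by rewrite size_polyX addn2.
  rewrite big_ord_recl coefMX eqxx scale0r add0r.
  by apply: eq_bigr => i _; rewrite coefMX.
rewrite {2}/diffop_lmulD diffop_mulDl mulX !(@diffop_mulE n) ?size_poly //.
rewrite lmulD_sum -big_split; apply: eq_bigr => i _ /=.
by rewrite lmulDZ coef_map_id0 ?der0.
Qed.

Lemma iter_lmulD_mul n P Q :
  iter n diffop_lmulD (diffop_mul P Q) = diffop_mul (iter n diffop_lmulD P) Q.
Proof. by elim: n => //= n ->; rewrite lmulD_mul. Qed.

Lemma diffop_mulA P Q S :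
  diffop_mul P (diffop_mul Q S) = diffop_mul (diffop_mul P Q) S.
Proof.
rewrite [diffop_mul P Q](@diffop_mulE (size P)) // diffop_mul_suml.
apply: eq_bigr => i _.
by rewrite iter_lmulD_mul diffop_mulZl.
Qed.

Lemma diffop_oner_neq0 : (1 : {poly A}) != 0.
Proof. exact: oner_neq0. Qed.

End DiffopRing.

HB.instance Definition _ (A : diffRingType) :=
  GRing.Zmodule_isNzRing.Build (diffop A) (@diffop_mulA A)
    (@diffop_mul1l A) (@diffop_mul1r A) (@diffop_mulDl A) (@diffop_mulDr A)
    (@diffop_oner_neq0 A).

Definition diffop_fun (A : diffRingType) (a : A) : diffop A := a%:P.

Definition diffop_D (A : diffRingType) : diffop A := 'X.

(* The substitution $\sum_i a_i \partial^i \mapsto \sum_i f(a_i) y^i$; it is a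
   ring morphism as soon as [y * f a = f a * y + f (der a)]. *)
Definition diffop_subst (A : diffRingType) (S : nzRingType) (f : A -> S)
    (y : S) (P : diffop A) : S :=
  \sum_(i < size (P : {poly A})) f (P : {poly A})`_i * y ^+ i.

Section DiffopTheory.
Variable A : diffRingType.
Implicit Types (a b : A) (P Q : diffop A).
Local Notation fn := (@diffop_fun A).
Local Notation D := (diffop_D A).

Lemma diffop_mulfn a Q : fn a * Q = a *: (Q : {poly A}) :> {poly A}.
Proof.
rewrite [LHS](@diffop_mulE _ 1) ?size_polyC ?leq_b1 //.
by rewrite big_ord1 coefC.
Qed.

Lemma diffop_mulD Q : D * Q = diffop_lmulD Q.
Proof.
rewrite [LHS](@diffop_mulE _ 2) ?size_polyX //.
by rewrite !big_ord_recl big_ord0 !coefX /= scale0r scale1r add0r addr0.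
Qed.

Lemma diffop_fun_is_zmod_morphism : zmod_morphism fn.
Proof. by move=> a b; rewrite /diffop_fun polyCB. Qed.

Lemma diffop_fun_is_monoid_morphism : monoid_morphism fn.
Proof.
split=> // a b; rewrite [RHS]diffop_mulfn.
by rewrite /diffop_fun polyCM mul_polyC.
Qed.

HB.instance Definition _ :=
  GRing.isZmodMorphism.Build A (diffop A) fn diffop_fun_is_zmod_morphism.
HB.instance Definition _ :=
  GRing.isMonoidMorphism.Build A (diffop A) fn diffop_fun_is_monoid_morphism.

Lemma diffop_funM a b : fn (a * b) = fn a * fn b.
Proof. exact: rmorphM. Qed.

Lemma diffop_commD a : D * fn a = fn a * D + fn (der a).
Proof.
rewrite diffop_mulD [X in _ = X + _]diffop_mulfn /diffop_lmulD /diffop_fun.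
rewrite mul_polyC addrC; congr (_ + _); apply/polyP => i.
by rewrite coef_map_id0 ?der0 // !coefC; case: eqP; rewrite ?der0.
Qed.

Lemma diffop_commDB g a :
  (D - fn g) * fn a = fn a * (D - fn g) + fn (der a).
Proof.
by rewrite mulrBl mulrBr diffop_commD -!diffop_funM (mulrC g a) addrAC.
Qed.

Lemma diffop_DXn n : D ^+ n = 'X^n :> {poly A}.
Proof. by elim: n => [|n IHn] //; rewrite exprS diffop_mulD IHn -!iter_lmulD1. Qed.

Lemma diffopE P :
  P = \sum_(i < size (P : {poly A})) fn (P : {poly A})`_i * D ^+ i.
Proof.
rewrite -{1}[P : {poly A}]coefK poly_def; apply: eq_bigr => i _.
by rewrite [RHS]diffop_mulfn diffop_DXn.
Qed.

Section Subst.
Variables (S : nzRingType) (f : {rmorphism A -> S}) (y : S).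
Local Notation subst := (diffop_subst f y).

Lemma diffop_substE n P : (size (P : {poly A}) <= n)%N ->
  subst P = \sum_(i < n) f (P : {poly A})`_i * y ^+ i.
Proof.
move=> le_n; rewrite /diffop_subst (big_ord_widen n
  (fun i => f (P : {poly A})`_i * y ^+ i)) // big_mkcond /=.
apply: eq_bigr => i _; case: ltnP => // le_i.
by rewrite nth_default // rmorph0 mul0r.
Qed.

Lemma diffop_subst_is_zmod_morphism : zmod_morphism subst.
Proof.
move=> P Q; pose n := maxn (size (P : {poly A})) (size (Q : {poly A})).
rewrite !(@diffop_substE n) ?leq_maxl ?leq_maxr //; last first.
  by rewrite (leq_trans (size_polyD _ _)) // size_polyN.
by rewrite -sumrB; apply: eq_bigr => i _; rewrite coefB rmorphB mulrBl.
Qed.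

Lemma diffop_subst_fun a : subst (fn a) = f a.
Proof.
by rewrite (@diffop_substE 1) ?size_polyC ?leq_b1 // big_ord1 coefC mulr1.
Qed.

Lemma diffop_subst_D : subst D = y.
Proof.
rewrite (@diffop_substE 2) ?size_polyX // !big_ord_recl big_ord0 !coefX /=.
by rewrite rmorph0 rmorph1 mul0r add0r addr0 mul1r expr1.
Qed.

Hypothesis commf : forall a, y * f a = f a * y + f (der a).

Lemma diffop_subst_is_monoid_morphism : monoid_morphism subst.
Proof.
have sB := diffop_subst_is_zmod_morphism.
have s0 : subst 0 = 0 by have := sB 0 0; rewrite !subrr.
have sD P Q : subst (P + Q) = subst P + subst Q.
  have sN R : subst (- R) = - subst R by rewrite -sub0r sB s0 sub0r.
  by rewrite -{1}[Q]opprK sB sN opprK.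
have ssum n (F : 'I_n -> diffop A) :
    subst (\sum_(i < n) F i) = \sum_(i < n) subst (F i).
  by apply: (big_morph _ sD s0).
have sfn a Q : subst (fn a * Q) = f a * subst Q.
  pose n := size (Q : {poly A}).
  rewrite !(@diffop_substE n) // ?diffop_mulfn ?size_scale_leq // mulr_sumr.
  by apply: eq_bigr => i _; rewrite ?diffop_mulfn coefZ rmorphM mulrA.
have sDm Q : subst (D * Q) = y * subst Q.
  rewrite [in RHS](@diffop_substE (size (Q : {poly A}))) //.
  rewrite {1}[Q]diffopE mulr_sumr ssum mulr_sumr; apply: eq_bigr => i _.
  have sXn a j : subst (fn a * D ^+ j) = f a * y ^+ j.
    rewrite sfn; congr (_ * _).
    rewrite (@diffop_substE j.+1) diffop_DXn ?size_polyXn //.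
    rewrite big_ord_recr /= coefXn eqxx rmorph1 mul1r big1 ?add0r // => k _.
    by rewrite coefXn ltn_eqF // rmorph0 mul0r.
  by rewrite !mulrA diffop_commD mulrDl -mulrA -exprS sD !sXn commf mulrDl
             -mulrA -exprS.
have sDn n Q : subst (D ^+ n * Q) = y ^+ n * subst Q.
  by elim: n => [|n IHn]; rewrite ?mul1r // !exprS -!mulrA sDm IHn.
split; first by rewrite -[1]/(fn 1) diffop_subst_fun rmorph1.
move=> P Q; rewrite [in LHS](diffopE P) mulr_suml ssum.
rewrite [subst P](@diffop_substE (size (P : {poly A}))) // mulr_suml.
by apply: eq_bigr => i _; rewrite -mulrA sfn sDn mulrA.
Qed.

End Subst.
End DiffopTheory.

Section DiffopMap.
Variables (A B : diffRingType) (h : {rmorphism A -> B}).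
Hypothesis h_der : forall a, h (der a) = der (h a).

Lemma map_lmulD (Q : {poly A}) :
  map_poly h (diffop_lmulD Q) = diffop_lmulD (map_poly h Q).
Proof.
apply/polyP => i; rewrite coef_lmulD !coef_map /= coef_lmulD rmorphD /= h_der.
by case: eqP => _; rewrite ?rmorph0 ?coef_map.
Qed.

Lemma map_diffop_mul (P Q : {poly A}) :
  map_poly h (diffop_mul P Q) = diffop_mul (map_poly h P) (map_poly h Q).
Proof.
rewrite (@diffop_mulE _ (size P) (map_poly h P)) ?size_poly // rmorph_sum.
apply: eq_bigr => i _; rewrite /= map_polyZ coef_map; congr (_ *: _).
by elim: (val i) => //= n <-; rewrite map_lmulD.
Qed.

End DiffopMap.

HB.instance Definition _ (R : comNzRingType) :=
  isDifferential.Build {poly R} (@derivD R) (@derivM R).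

Definition ratfun (F : fieldType) : Type := {fraction {poly F}}.
HB.instance Definition _ (F : fieldType) := GRing.Field.on (ratfun F).

Definition of_poly (F : fieldType) (p : {poly F}) : ratfun F := tofrac p.
HB.instance Definition _ (F : fieldType) :=
  GRing.RMorphism.copy (@of_poly F) (@tofrac {poly F}).

Section RatfunDerivation.
Variable F : fieldType.
Local Notation "p %:F" := (@of_poly F p).

Lemma of_poly_eq0 (p : {poly F}) : (p%:F == 0) = (p == 0).
Proof. exact: tofrac_eq0. Qed.

Lemma of_poly_inj : injective (@of_poly F).
Proof.
move=> p q /eqP; rewrite -subr_eq0 -rmorphB of_poly_eq0 subr_eq0.
by move/eqP.
Qed.

Definition ratfun_num (f : ratfun F) : {poly F} :=
  let r : {ratio {poly F}} := repr (f : {fraction {poly F}}) in \n_r.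
Definition ratfun_den (f : ratfun F) : {poly F} :=
  let r : {ratio {poly F}} := repr (f : {fraction {poly F}}) in \d_r.

Lemma ratfun_den_neq0 f : ratfun_den f != 0.
Proof. exact: denom_ratioP. Qed.

Lemma ratfun_numden f : f = (ratfun_num f)%:F / (ratfun_den f)%:F.
Proof.
have d0 := ratfun_den_neq0 f.
suff E : f * (ratfun_den f)%:F = (ratfun_num f)%:F.
  by rewrite -E mulfK // of_poly_eq0.
rewrite /ratfun_num /ratfun_den in d0 *.
rewrite -{1}[f : {fraction {poly F}}](reprK) /of_poly /tofrac.
unlock FracField.tofrac; rewrite -[LHS]FracField.pi_mul.
rewrite /FracField.mulf !numden_Ratio ?oner_neq0 // mulr1.
by apply/eqmodP; rewrite /= FracField.equivfE !numden_Ratio ?oner_neq0 // mulr1 mulrC.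
Qed.

(* quotient rule *)
Definition ratfun_der (f : ratfun F) : ratfun F :=
  let n := ratfun_num f in let d := ratfun_den f in
  (n^`() * d - n * d^`())%:F / (d ^+ 2)%:F.

Lemma ratfun_derE (n d : {poly F}) : d != 0 ->
  ratfun_der (n%:F / d%:F) = (n^`() * d - n * d^`())%:F / (d ^+ 2)%:F.
Proof.
move=> d0; set f := n%:F / d%:F; rewrite /ratfun_der.
have e0 := ratfun_den_neq0 f; have := ratfun_numden f.
move: (ratfun_num f) (ratfun_den f) e0 => m e e0.
have F0 p : p != 0 -> p%:F != 0 by rewrite of_poly_eq0.
rewrite /f => /eqP; rewrite eqr_div ?F0 // -!rmorphM => /eqP/of_poly_inj E.
apply/eqP; rewrite eqr_div ?F0 ?expf_neq0 // -!rmorphM; apply/eqP.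
congr _%:F; have /(congr1 (@deriv F)) := E; rewrite !derivM => E'.
have -> : (m^`() * e - m * e^`()) * d ^+ 2 =
    (m^`() * d + m * d^`()) * (e * d) - m * d * (d^`() * e + e^`() * d).
  by rewrite mulrBl !mulrDl !mulrDr opprD !expr2 addrACA;
     rewrite -!mulrA ![d * (_ * _)]mulrCA ![d^`() * _]mulrCA; ring.
rewrite -E' -E; ring.
Qed.

Lemma ratfun_derD : {morph ratfun_der : f g / f + g}.
Proof.
move=> f g; rewrite [f]ratfun_numden [g]ratfun_numden.
move: (ratfun_den_neq0 f) (ratfun_den_neq0 g).
move: (ratfun_num f) (ratfun_den f) (ratfun_num g) (ratfun_den g).
move=> n d m e d0 e0.
have F0 p : p != 0 -> p%:F != 0 by rewrite of_poly_eq0.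
rewrite addf_div ?F0 // -!rmorphM -rmorphD !ratfun_derE ?mulf_neq0 //.
rewrite addf_div ?F0 ?expf_neq0 // -!rmorphM -rmorphD.
apply/eqP; rewrite eqr_div ?F0 ?mulf_neq0 ?expf_neq0 ?mulf_neq0 //.
rewrite -!rmorphM !derivD !derivM; apply/eqP; congr _%:F; ring.
Qed.

Lemma ratfun_derM f g :
  ratfun_der (f * g) = ratfun_der f * g + f * ratfun_der g.
Proof.
rewrite [f]ratfun_numden [g]ratfun_numden.
move: (ratfun_den_neq0 f) (ratfun_den_neq0 g).
move: (ratfun_num f) (ratfun_den f) (ratfun_num g) (ratfun_den g).
move=> n d m e d0 e0.
have F0 p : p != 0 -> p%:F != 0 by rewrite of_poly_eq0.
rewrite mulf_div -!rmorphM !ratfun_derE ?mulf_neq0 //.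
rewrite !mulf_div -!rmorphM addf_div ?F0 ?mulf_neq0 ?expf_neq0 //.
rewrite -!rmorphM -rmorphD.
apply/eqP; rewrite eqr_div ?F0 ?mulf_neq0 ?expf_neq0 ?mulf_neq0 //.
rewrite -!rmorphM !derivM; apply/eqP; congr _%:F; ring.
Qed.

Lemma ratfun_der_poly p : ratfun_der p%:F = (p^`())%:F.
Proof.
have -> : p%:F = p%:F / 1%:F by rewrite rmorph1 divr1.
rewrite ratfun_derE ?oner_neq0 // derivC mulr0 subr0 mulr1.
by rewrite expr1n rmorph1 divr1.
Qed.

End RatfunDerivation.

HB.instance Definition _ (F : fieldType) :=
  isDifferential.Build (ratfun F) (@ratfun_derD F) (@ratfun_derM F).

Definition weyl (F : fieldType) : Type := diffop {poly F}.
HB.instance Definition _ (F : fieldType) := GRing.NzRing.on (weyl F).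

Definition weylfrac (F : fieldType) : Type := diffop (ratfun F).
HB.instance Definition _ (F : fieldType) := GRing.NzRing.on (weylfrac F).

Definition weyl_coef (F : fieldType) (P : weyl F) (i : nat) : {poly F} :=
  (P : {poly {poly F}})`_i.

Definition weyl_x (F : fieldType) : weyl F := diffop_fun ('X : {poly F}).

Definition weyl_D (F : fieldType) : weyl F := diffop_D {poly F}.

Definition weyl_const (F : fieldType) (c : F) : weyl F := diffop_fun c%:P.

Definition weyl_to_frac (F : fieldType) (P : weyl F) : weylfrac F :=
  map_poly (@of_poly F) (P : {poly {poly F}}).

Definition diffop_ord (A : diffRingType) (P : diffop A) : nat :=
  (size (P : {poly A})).-1.

Definition weyl_deg (F : fieldType) (P : weyl F) : nat :=
  \max_(i < (diffop_ord P).+1) (size (weyl_coef P i)).-1.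

(* $p \mapsto p(y)$ *)
Definition weyl_poly (F : fieldType) (y : weyl F) (p : {poly F}) : weyl F :=
  (map_poly (@weyl_const F) p).[y].

Definition laplace (F : fieldType) : weyl F -> weyl F :=
  diffop_subst (weyl_poly (- weyl_D F)) (weyl_x F).

Definition laplace_inv (F : fieldType) : weyl F -> weyl F :=
  diffop_subst (weyl_poly (weyl_D F)) (- weyl_x F).

Definition Ad (F : fieldType) (c lam : F) : weylfrac F -> weylfrac F :=
  diffop_subst (@diffop_fun (ratfun F))
    (diffop_D (ratfun F) - diffop_fun (of_poly lam%:P / of_poly ('X - c%:P))).

Section WeylTheory.
Variable F : fieldType.
Implicit Types (P Q : weyl F) (p : {poly F}) (c : F).

Lemma weyl_comm : weyl_D F * weyl_x F - weyl_x F * weyl_D F = 1.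
Proof.
rewrite [weyl_D F * _]diffop_commD addrAC subrr add0r.
by rewrite [der _]derivX rmorph1.
Qed.

HB.instance Definition _ :=
  GRing.RMorphism.copy (@weyl_const F) (@diffop_fun {poly F} \o @polyC F).

Lemma weyl_constC c Q : weyl_const c * Q = Q * weyl_const c.
Proof.
have cD i : weyl_const c * weyl_D F ^+ i = weyl_D F ^+ i * weyl_const c.
  elim: i => [|i IHi]; first by rewrite mulr1 mul1r.
  have cD1 : weyl_D F * weyl_const c = weyl_const c * weyl_D F.
    by rewrite [LHS]diffop_commD [der _]derivC rmorph0 addr0.
  by rewrite exprS mulrA -cD1 -!mulrA IHi.
rewrite [Q]diffopE mulr_sumr mulr_suml; apply: eq_bigr => i _.
rewrite -[RHS]mulrA -[X in _ = _ * X]cD [LHS]mulrA [RHS]mulrA; congr (_ * _).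
by rewrite /weyl_const -!diffop_funM mulrC.
Qed.

Lemma weyl_poly_comm (y : weyl F) : commr_rmorph (@weyl_const F) y.
Proof. by move=> c; apply/esym/weyl_constC. Qed.

HB.instance Definition _ (y : weyl F) :=
  GRing.RMorphism.copy (weyl_poly y) (horner_morph (weyl_poly_comm y)).

Lemma weyl_polyC (y : weyl F) c : weyl_poly y c%:P = weyl_const c.
Proof. exact: (horner_morphC (weyl_poly_comm y)). Qed.

Lemma weyl_polyX (y : weyl F) : weyl_poly y 'X = y.
Proof. exact: (horner_morphX (weyl_poly_comm y)). Qed.

Lemma weyl_poly_der (u y : weyl F) p : y * u = u * y + 1 ->
  y * weyl_poly u p = weyl_poly u p * y + weyl_poly u p^`().
Proof.
move=> yu; elim/poly_ind: p => [|p c IHp].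
  by rewrite deriv0 !rmorph0 mulr0 mul0r addr0.
rewrite derivD derivM derivX derivC mulr1 addr0.
rewrite !rmorphD !rmorphM /= !weyl_polyX !weyl_polyC mulrDr mulrDl mulrA IHp.
rewrite -weyl_constC mulrDl -[_ * y * u]mulrA yu mulrDr mulr1 !mulrA.
by rewrite -!addrA; congr (_ + _); rewrite addrC -addrA addrCA.
Qed.

Lemma weyl_commN_D : weyl_x F * - weyl_D F = - weyl_D F * weyl_x F + 1.
Proof. by rewrite -weyl_comm mulrN mulNr addrA addNr sub0r. Qed.

Lemma weyl_commN_x : - weyl_x F * weyl_D F = weyl_D F * - weyl_x F + 1.
Proof. by rewrite -weyl_comm mulrN mulNr addrA addNr sub0r. Qed.

HB.instance Definition _ := GRing.isZmodMorphism.Build (weyl F) (weyl F)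
  (@laplace F) (diffop_subst_is_zmod_morphism _ _).
HB.instance Definition _ := GRing.isMonoidMorphism.Build (weyl F) (weyl F)
  (@laplace F) (diffop_subst_is_monoid_morphism
    (fun p => weyl_poly_der p weyl_commN_D)).

HB.instance Definition _ := GRing.isZmodMorphism.Build (weyl F) (weyl F)
  (@laplace_inv F) (diffop_subst_is_zmod_morphism _ _).
HB.instance Definition _ := GRing.isMonoidMorphism.Build (weyl F) (weyl F)
  (@laplace_inv F) (diffop_subst_is_monoid_morphism
    (fun p => weyl_poly_der p weyl_commN_x)).

Lemma laplace_const c : laplace (weyl_const c) = weyl_const c.
Proof. by rewrite /laplace [LHS]diffop_subst_fun /= weyl_polyC. Qed.

Lemma laplace_x : laplace (weyl_x F) = - weyl_D F.
Proof. by rewrite /laplace [LHS]diffop_subst_fun /= weyl_polyX. Qed.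

Lemma laplace_D : laplace (weyl_D F) = weyl_x F.
Proof. exact: diffop_subst_D. Qed.

Lemma laplace_inv_const c : laplace_inv (weyl_const c) = weyl_const c.
Proof. by rewrite /laplace_inv [LHS]diffop_subst_fun /= weyl_polyC. Qed.

Lemma laplace_inv_x : laplace_inv (weyl_x F) = weyl_D F.
Proof. by rewrite /laplace_inv [LHS]diffop_subst_fun /= weyl_polyX. Qed.

Lemma laplace_inv_D : laplace_inv (weyl_D F) = - weyl_x F.
Proof. exact: diffop_subst_D. Qed.

Lemma weyl_endo_id (f : {rmorphism weyl F -> weyl F}) :
    (forall c, f (weyl_const c) = weyl_const c) ->
    f (weyl_x F) = weyl_x F -> f (weyl_D F) = weyl_D F ->
  f =1 id.
Proof.
move=> fc fx fD P.
have fp p : f (diffop_fun p) = diffop_fun p.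
  elim/poly_ind: p => [|p c IHp]; first by rewrite !rmorph0.
  rewrite rmorphD rmorphM /= rmorphD rmorphM /= IHp.
  by rewrite [f (diffop_fun 'X)]fx [f (diffop_fun c%:P)]fc.
rewrite {1}[P]diffopE rmorph_sum [RHS]diffopE; apply: eq_bigr => i _ /=.
by rewrite rmorphM rmorphXn /= fp [f (diffop_D _)]fD.
Qed.

Lemma laplaceK : cancel (@laplace F) (@laplace_inv F).
Proof.
apply: (weyl_endo_id (f := @laplace_inv F \o @laplace F)) => [c||] /=.
- by rewrite laplace_const laplace_inv_const.
- by rewrite laplace_x rmorphN /= laplace_inv_D opprK.
- by rewrite laplace_D laplace_inv_x.
Qed.

Lemma laplace_invK : cancel (@laplace_inv F) (@laplace F).
Proof.
apply: (weyl_endo_id (f := @laplace F \o @laplace_inv F)) => [c||] /=.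
- by rewrite laplace_inv_const laplace_const.
- by rewrite laplace_inv_x laplace_D.
- by rewrite laplace_inv_D rmorphN /= laplace_x opprK.
Qed.

Section AdTheory.
Variables c lam : F.

Lemma Ad_commf (f : ratfun F) :
  let g : ratfun F := of_poly lam%:P / of_poly ('X - c%:P) in
  (diffop_D _ - diffop_fun g) * diffop_fun f =
    diffop_fun f * (diffop_D _ - diffop_fun g) + diffop_fun (der f).
Proof.
exact: diffop_commDB.
Qed.

HB.instance Definition _ := GRing.isZmodMorphism.Build (weylfrac F)
  (weylfrac F) (Ad c lam) (diffop_subst_is_zmod_morphism _ _).
HB.instance Definition _ := GRing.isMonoidMorphism.Build (weylfrac F)
  (weylfrac F) (Ad c lam) (diffop_subst_is_monoid_morphism Ad_commf).

Lemma Ad_fun (f : ratfun F) : Ad c lam (diffop_fun f) = diffop_fun f.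
Proof. exact: diffop_subst_fun. Qed.

Lemma Ad_D : Ad c lam (diffop_D _) =
  diffop_D _ - diffop_fun (of_poly lam%:P / of_poly ('X - c%:P)).
Proof. exact: diffop_subst_D. Qed.

End AdTheory.
End WeylTheory.

(* [Q] lies in $\mathbb C(x) P \cap W[x]$ *)
Definition in_ratfun_multiples (F : fieldType) (P : weylfrac F) (Q : weyl F) :=
  exists f : ratfun F, weyl_to_frac Q = diffop_fun f * P.

(* The zero operator lies in every $\mathbb C(x)P\cap W[x]$ and is excluded;
   the minimizers are then determined up to a nonzero constant factor. *)
Definition is_reduced_rep (F : fieldType) (P : weylfrac F) (Q : weyl F) :=
  [/\ Q != 0, in_ratfun_multiples P Q &
      forall Q' : weyl F, Q' != 0 -> in_ratfun_multiples P Q' ->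
        (weyl_deg Q <= weyl_deg Q')%N].

Definition redrep (F : fieldType) (P : weylfrac F) : weyl F :=
  xget 0 [set Q | is_reduced_rep P Q]%classic.

Definition RAd (F : fieldType) (c lam : F) (P : weylfrac F) : weyl F :=
  redrep (Ad c lam P).

Definition euler0 (F : fieldType) (lam : F) (P : weylfrac F) : weyl F :=
  laplace (RAd 0 (- lam) (weyl_to_frac (laplace_inv (redrep P)))).

Lemma weyl_to_frac_eq0 (F : fieldType) (P : weyl F) :
  (weyl_to_frac P == 0) = (P == 0).
Proof.
apply/eqP/eqP => [P0|->]; last by rewrite /weyl_to_frac map_poly0.
apply/polyP => i; apply: of_poly_inj; rewrite coef0 rmorph0.
have := congr1 (fun Q : {poly ratfun F} => Q`_i) P0.
by rewrite coef_map coef0.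
Qed.

Lemma weyl_to_frac_is_monoid_morphism (F : fieldType) :
  monoid_morphism (@weyl_to_frac F).
Proof.
split=> [|P Q]; first exact: (rmorph1 (map_poly (@of_poly F))).
by apply: map_diffop_mul => p; exact/esym/ratfun_der_poly.
Qed.

HB.instance Definition _ (F : fieldType) :=
  GRing.isZmodMorphism.Build (weyl F) (weylfrac F) (@weyl_to_frac F)
    (@rmorphB _ _ (map_poly (@of_poly F))).
HB.instance Definition _ (F : fieldType) :=
  GRing.isMonoidMorphism.Build (weyl F) (weylfrac F) (@weyl_to_frac F)
    (@weyl_to_frac_is_monoid_morphism F).

Lemma redrepP (F : fieldType) (P : weylfrac F) :
  P != 0 -> is_reduced_rep P (redrep P).
Proof.
move=> P0; apply: xgetPex.
have [Q Q0 QP] : exists2 Q : weyl F, Q != 0 & in_ratfun_multiples P Q.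
  have den (s : seq (ratfun F)) : exists2 d : {poly F}, d != 0 &
      exists t : seq {poly F}, forall i, of_poly d * s`_i = of_poly t`_i.
    elim: s => [|f s [d d0 [t tE]]].
      by exists 1; rewrite ?oner_neq0 //; exists [::] => i;
        rewrite !nth_nil mulr0 rmorph0.
    exists (ratfun_den f * d); first by rewrite mulf_neq0 ?ratfun_den_neq0.
    exists (ratfun_num f * d :: [seq ratfun_den f * p | p <- t]) => -[|i] /=.
      rewrite {2}[f]ratfun_numden !rmorphM /=.
      have aux (K : fieldType) (a b c : K) : a != 0 -> a * b * (c / a) = c * b.
        by move=> a0; rewrite mulrAC [a * _]mulrC divfK.
      by apply: aux; rewrite of_poly_eq0 ratfun_den_neq0.
    have -> : [seq ratfun_den f * p | p <- t]`_i = ratfun_den f * t`_i.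
      case: (ltnP i (size t)) => it; first by rewrite (nth_map 0).
      by rewrite !nth_default ?size_map ?mulr0.
    by rewrite !rmorphM /= -mulrA tE.
  have [d d0 [t tE]] := den (P : {poly ratfun F}).
  have E : weyl_to_frac (Poly t) = diffop_fun (of_poly d) * P.
    rewrite [RHS]diffop_mulfn; apply/polyP => i.
    by rewrite coefZ tE coef_map coef_Poly.
  exists (Poly t); last by exists (of_poly d).
  rewrite -weyl_to_frac_eq0 E [_ * _]diffop_mulfn.
  by rewrite [_ == _](@scaler_eq0 _ {poly ratfun F}) of_poly_eq0 (negPf d0).
pose S n := `[< exists Q : weyl F,
  [/\ Q != 0, in_ratfun_multiples P Q & weyl_deg Q = n] >].
have exS : exists n, S n by exists (weyl_deg Q); apply/asboolP; exists Q.
case: (ex_minnP exS) => n /asboolP[Q1 [Q10 Q1P <-]] Q1min.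
exists Q1; split=> // Q' Q'0 Q'P; apply: Q1min.
by apply/asboolP; exists Q'.
Qed.

(* [redrep] absorbs left factors in $\mathbb C[x]$, so the order of an Euler
   transform does not change when $P$ becomes $f(x)P$, whereas [weyl_deg P]
   does; a bound on the degree that is equivalent to a condition on the Euler
   transform has to involve the degree of the reduced representative. *)
Lemma deg_redrep_le (F : fieldType) (P : weyl F) :
  P != 0 -> (weyl_deg (redrep (weyl_to_frac P)) <= weyl_deg P)%N.
Proof.
move=> P0; have := P0; rewrite -weyl_to_frac_eq0 => /redrepP[_ _]; apply=> //.
by exists 1; rewrite rmorph1 mul1r.
Qed.

Lemma deg_redrep_reduced (F : fieldType) (P : weyl F) :
  is_reduced_rep (weyl_to_frac P) P ->
  weyl_deg (redrep (weyl_to_frac P)) = weyl_deg P.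
Proof.
move=> [P0 _ Pmin]; apply/eqP; rewrite eqn_leq deg_redrep_le //=.
have := P0; rewrite -weyl_to_frac_eq0 => /redrepP[Q0 QP _].
exact: Pmin.
Qed.

(* Fuchs' criterion: $\deg p_i - i \le \deg p_N - N$ for $P=\sum_{i\le N}
   p_i(x)\partial^i$ of order $N$, i.e. $P = a(x)\sum_i b_i(1/x) x^i \partial^i$
   with $b_i$ holomorphic at $0$ and $b_N(0)\neq 0$. *)
Definition regular_singular_infty (F : fieldType) (P : weyl F) :=
  P != 0 /\
  forall i, weyl_coef P i != 0 ->
    (size (weyl_coef P i) + diffop_ord P <=
       size (weyl_coef P (diffop_ord P)) + i)%N.

(* The polynomials in $P = \sum_{s\ge 0} x^{\rho-s}P_s(\partial)$.  Here
   $\rho = \deg P$, as forced by $P_0 \neq 0$; $P_s = 0$ for $s > \rho$. *)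
Definition infty_coef (F : fieldType) (P : weyl F) (s : nat) : {poly F} :=
  if (s <= weyl_deg P)%N then
    \poly_(i < (diffop_ord P).+1) (weyl_coef P i)`_(weyl_deg P - s)
  else 0.

Definition pochhammer (F : fieldType) (a : F) (k : nat) : F :=
  \prod_(t < k) (a + t%:R).

Definition infty_poly (F : fieldType) (P : weyl F) (k : nat) (lam : F) :
    {poly F} :=
  \sum_(i < k.+1)
    (pochhammer (lam + i%:R + 1) (k - i) / ((k - i)`!)%:R)
      *: (infty_coef P i)^`(k - i).

Definition semisimple_exponents_infty (F : fieldType) (P : weyl F) (l : nat)
    (mu : 'I_l -> F) (m : 'I_l -> nat) :=
  let M := (\sum_(i < l) m i)%N in
  [/\ forall i j : nat, (i + j < M)%N -> ((infty_coef P i)^`(j)).[0] = 0,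
      ((infty_coef P 0)^`(M)).[0] != 0 &
      forall (i : 'I_l) (j k : nat),
        (j < m i)%N -> (M <= k)%N -> (k + j < M + m i)%N ->
        (infty_poly P k (- mu i - j%:R - k%:R)).[0] = 0].

Definition is_integer (F : fieldType) (a : F) := exists z : int, a = z%:~R.

(* Main.v *)
Require Import Defs.
From HB Require Import structures.
From mathcomp Require Import all_boot all_order all_algebra.
From mathcomp Require Import boolp reals complex.
From mathcomp Require Import ring zify.

Import GRing.Theory Num.Theory.
Local Open Scope ring_scope.
Local Open Scope complex_scope.

(* Let $Q$ be the reduced representative of $P$, $N=\deg Q$, $n=\mathrm{ord}\,Q$,
   $\lambda=\mu_i-1$, $T=\mathcal L^{-1}Q$ and
   $S=\mathrm{Ad}(x^{-\lambda})T=x^{-\lambda}\circ T\circ x^{\lambda}$.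
   The Laplace transform exchanges order and degree, so the order of the Euler
   transform is the degree of the reduced representative of $S$.  Regularity of
   $Q$ at $\infty$ makes $c x^n$ the leading coefficient of $T$ and of $S$, and
   the coefficients of $S$ are Laurent polynomials of degree at most $n$; hence
   that degree is smaller than $n$ iff $x^{-1}S\in W[x]$, that is, iff $T$ maps
   $x^{\lambda}\mathbb C[x]$ into $x^{\lambda+1}\mathbb C[x]$.  Comparing
   $\partial^a(-x)^b x^{\lambda+t}$ with $x^a\partial^b x^{-\mu_i-t}$, this
   means that for $0\le t\le w$ the coefficient of $x^{s+w}$ in $Q x^s$ vanishes
   at $s=-\mu_i-t$.  The exponents give this vanishing for
   $t+(N-n-w)<n_i$, hence for all $t\le w$ if $N-n<n_i$.  Otherwise $w=N-n$ and
   $t=n_i$ would provide an $(n+1)$-st root of the indicial polynomial of degree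
   $n$, besides the exponents. *)

Set Implicit Arguments.
Unset Strict Implicit.

(** * Action of differential operators and Laplace transform *)

Section DiffopAction.
Variable A : diffRingType.
Implicit Types (a b g : A) (P Q : diffop A).
Local Notation fn := (@diffop_fun A).
Local Notation D := (diffop_D A).

Definition diffop_act P a : A :=
  \sum_(i < size (P : {poly A})) (P : {poly A})`_i * iter i der a.

(* Since $\partial$ kills $1$, the action is $P\cdot a=(P\circ a)\cdot 1$, the
   coefficient of $\partial^0$ in $P\circ a$. *)
Lemma coef0_mul P Q :
  (P * Q : {poly A})`_0 = diffop_act P (Q : {poly A})`_0.
Proof.
rewrite [(P * Q : {poly A})](@diffop_mulE _ (size (P : {poly A}))) // coef_sum.
apply: eq_bigr => i _; rewrite coefZ; congr (_ * _).
by elim: (val i) => //= k <-; rewrite coef_lmulD addr0.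
Qed.

Lemma diffop_actE P a : diffop_act P a = (P * fn a : {poly A})`_0.
Proof. by rewrite coef0_mul coefC. Qed.

Lemma diffop_actM P Q a : diffop_act (P * Q) a = diffop_act P (diffop_act Q a).
Proof. by rewrite diffop_actE -mulrA coef0_mul -diffop_actE. Qed.

Lemma diffop_actDl P Q a :
  diffop_act (P + Q) a = diffop_act P a + diffop_act Q a.
Proof. by rewrite !diffop_actE mulrDl coefD. Qed.

Lemma diffop_act_sum (I : Type) (r : seq I) (C : pred I) (G : I -> diffop A) a :
  diffop_act (\sum_(i <- r | C i) G i) a = \sum_(i <- r | C i) diffop_act (G i) a.
Proof.
apply: (big_morph (fun P => diffop_act P a)) => [P Q|]; first exact: diffop_actDl.
by rewrite diffop_actE mul0r coef0.
Qed.

Lemma diffop_act_fun b a : diffop_act (fn b) a = b * a.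
Proof. by rewrite diffop_actE -rmorphM coefC. Qed.

Lemma diffop_act_D a : diffop_act D a = der a.
Proof.
by rewrite diffop_actE diffop_mulD coef_lmulD coefC addr0.
Qed.

Lemma coef_funM b P i : (fn b * P : {poly A})`_i = b * (P : {poly A})`_i.
Proof. by rewrite diffop_mulfn coefZ. Qed.

(** Commuting $\partial$ past a function, or expanding $g$, costs at least one order, so
    $(\partial-g)^k a=a\partial^k$ plus terms of order below $k$. *)
Lemma coef_exp_D_fun g a k i : (k <= i)%N ->
  ((D - fn g) ^+ k * fn a : {poly A})`_i = a *+ (i == k).
Proof.
elim: k i => [|k IHk] i; first by rewrite mul1r coefC; case: i.
case: i => // i le_ki; rewrite exprS -mulrA mulrBl coefB coef_funM diffop_mulD.
rewrite coef_lmulD /= !IHk ?(ltnW le_ki) //.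
by rewrite [i.+1 == k]gtn_eqF // mulr0n der0 mulr0 subr0 add0r.
Qed.

End DiffopAction.

(** * Order and degree under the Laplace transform *)

Section LaplaceCoefficients.
Variable F : fieldType.
Implicit Types (p z : {poly F}) (P Q : weyl F) (e : F).

Lemma weyl_polyE (y : weyl F) n p : (size p <= n)%N ->
  weyl_poly y p = \sum_(a < n) weyl_const p`_a * y ^+ a.
Proof.
move=> le_pn; rewrite /weyl_poly (@horner_coef_wide _ n) ?(leq_trans (size_poly _ _)) //.
by apply: eq_bigr => a _; rewrite coef_map_id0 // rmorph0.
Qed.

(** The case $e=-1$ serves $\mathcal L$ and $e=1$ serves $\mathcal L^{-1}$. The number $N$ only
    bounds the degree of $p$, so that one $N$ fits all coefficients of an operator. *)
Lemma coef_weyl_poly_fun e p z N i : (size p <= N.+1)%N -> (N <= i)%N ->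
  weyl_coef (weyl_poly (weyl_const e * weyl_D F) p * diffop_fun z) i =
    ((e ^+ N * p`_N) *: z) *+ (i == N).
Proof.
move=> le_pN le_Ni; rewrite /weyl_coef (weyl_polyE _ le_pN) mulr_suml coef_sum.
have E (a : 'I_N.+1) :
    (weyl_const p`_a * (weyl_const e * weyl_D F) ^+ a * diffop_fun z : {poly {poly F}})`_i =
    ((e ^+ a * p`_a) *: z) *+ (i == a).
  rewrite exprMn_comm; last exact: weyl_constC.
  rewrite -rmorphXn mulrA -rmorphM /= -mulrA coef_funM mulrC.
  rewrite -[weyl_D F]subr0 -(rmorph0 (@diffop_fun {poly F})) coef_exp_D_fun.
    by rewrite mulrC mulrnAr mul_polyC [p`_a * _]mulrC.
  by rewrite (leq_trans _ le_Ni) // -ltnS.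
rewrite (eq_bigr _ (fun a _ => E a)) big_ord_recr /= big1 ?add0r // => a _.
by rewrite [i == a]gtn_eqF // (leq_trans (ltn_ord a)).
Qed.

Lemma weyl_deg_leP Q d :
  reflect (forall i, (size (weyl_coef Q i) <= d.+1)%N) (weyl_deg Q <= d)%N.
Proof.
rewrite /weyl_deg; apply: (iffP (bigmax_leqP _ _ _)) => [H i|H i _]; last first.
  by have := H i; case: (size _).
case: (ltnP i (diffop_ord Q).+1) => [lti|lei].
  by have := H (Ordinal lti) isT => /=; case: (size _).
rewrite /weyl_coef nth_default ?size_poly0 //.
by move: lei; rewrite /diffop_ord; case: (size _) => // k; apply: leq_trans.
Qed.

Lemma weyl_deg_exists Q : Q != 0 ->
  exists i, size (weyl_coef Q i) = (weyl_deg Q).+1.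
Proof.
move=> Q0; have [i0 c0] : exists i, weyl_coef Q i != 0.
  by exists (diffop_ord Q); rewrite -lead_coef_eq0 in Q0.
(* In degree $0$ the truncated [.-1] does not tell a constant from $0$, so a nonzero coefficient is
   supplied by hand. *)
have [d0|d0] := posnP (weyl_deg Q).
  exists i0; apply/eqP; rewrite eqn_leq d0 size_poly_gt0 c0 andbT.
  by have /weyl_deg_leP := eq_leq d0; apply.
have [|i Ei] := @eq_bigmax _ (fun i : 'I_(diffop_ord Q).+1 =>
  (size (weyl_coef Q i)).-1); first by rewrite card_ord.
by exists i; move: d0; rewrite /weyl_deg Ei; case: (size _).
Qed.

(** Only the monomials $x^N\partial^b$ reach order $N$; each becomes $(e\partial)^N z^b$, with $e^N
    z^b$ at $\partial^N$. *)
Lemma coef_laplace_subst e z Q N i : (weyl_deg Q <= N <= i)%N ->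
  weyl_coef (diffop_subst (weyl_poly (weyl_const e * weyl_D F))
    (diffop_fun z) Q) i =
  (\sum_(b < size (Q : {poly {poly F}}))
     (e ^+ N * (weyl_coef Q b)`_N) *: z ^+ b) *+ (i == N).
Proof.
case/andP=> /weyl_deg_leP leQN leNi.
rewrite /diffop_subst /weyl_coef coef_sum -sumrMnl; apply: eq_bigr => b _.
by have := coef_weyl_poly_fun e (z ^+ b) (leQN b) leNi; rewrite rmorphXn.
Qed.

Lemma coef_laplace Q N i : (weyl_deg Q <= N <= i)%N ->
  weyl_coef (laplace Q) i =
  (\sum_(b < size (Q : {poly {poly F}}))
     ((-1) ^+ N * (weyl_coef Q b)`_N) *: 'X ^+ b) *+ (i == N).
Proof.
move=> /coef_laplace_subst <-.
by rewrite /laplace rmorphN1 mulN1r.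
Qed.

Lemma coef_laplace_inv Q N i : (weyl_deg Q <= N <= i)%N ->
  weyl_coef (laplace_inv Q) i =
  (\sum_(b < size (Q : {poly {poly F}}))
     (weyl_coef Q b)`_N *: (- 'X) ^+ b) *+ (i == N).
Proof.
move=> /(coef_laplace_subst 1 (- 'X)); rewrite rmorph1 mul1r rmorphN => ->.
by congr (_ *+ _); apply: eq_bigr => b _; rewrite expr1n mul1r.
Qed.

Lemma diffop_ord_eq (A : diffRingType) (S : diffop A) N :
    (S : {poly A})`_N != 0 -> (forall i, (N < i)%N -> (S : {poly A})`_i = 0) ->
  diffop_ord S = N.
Proof.
move=> SN0 S0; rewrite /diffop_ord; suff -> : size (S : {poly A}) = N.+1 by [].
apply/eqP; rewrite eqn_leq; apply/andP; split; first by apply/leq_sizeP => j /S0.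
by rewrite ltnNge; apply: contra SN0 => /leq_sizeP->.
Qed.

(** The coefficient of $\partial^N$, $N=\deg Q$, gathers the terms of degree $N$ of all coefficients
    of $Q$; distinct $b$ give distinct powers $x^b$, so nothing cancels. *)
Lemma ord_laplace Q : Q != 0 -> diffop_ord (laplace Q) = weyl_deg Q.
Proof.
move=> Q0; set N := weyl_deg Q.
have [b sb] := weyl_deg_exists Q0.
have E i (leNi : (N <= i)%N) := @coef_laplace Q N i (introT andP (conj (leqnn N) leNi)).
apply: diffop_ord_eq => [|i ltNi]; last first.
  by rewrite [LHS]E 1?ltnW // gtn_eqF.
rewrite [_`_ _]E // eqxx mulr1n.
rewrite -(poly_def _ (fun b => (-1) ^+ N * (weyl_coef Q b)`_N)).
apply/eqP => /polyP/(_ b)/eqP.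
rewrite coef_poly coef0 ifT; last first.
  rewrite ltnNge; apply/negP => leb.
  by move: sb; rewrite /weyl_coef nth_default // size_poly0.
rewrite mulf_eq0 signr_eq0 /= => /eqP p0.
have : lead_coef (weyl_coef Q b) == 0 by rewrite /lead_coef sb p0.
by rewrite lead_coef_eq0 => /eqP b0; rewrite b0 size_poly0 in sb.
Qed.

Lemma weyl_deg_laplace_inv Q :
  Q != 0 -> weyl_deg (laplace_inv Q) = diffop_ord Q.
Proof.
move=> Q0; rewrite -{2}(laplace_invK Q) ord_laplace //.
by rewrite raddf_eq0 //; exact: can_inj (@laplace_invK F).
Qed.

Lemma exprN_polyX n : (- 'X) ^+ n = (-1) ^+ n *: 'X^n :> {poly F}.
Proof.
elim: n => [|n IHn]; first by rewrite !expr0 scale1r.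
by rewrite !exprS IHn -scalerAr mulN1r scaleNr mulNr scalerN.
Qed.

(** * Regularity at infinity *)

Section RegularSingular.
Variable P : weyl F.
Hypothesis P_reg : regular_singular_infty P.

Lemma regular_size i :
  (size (weyl_coef P i) + diffop_ord P <=
     size (weyl_coef P (diffop_ord P)) + i)%N \/ weyl_coef P i = 0.
Proof. by have [->|/(P_reg.2 i)] := eqVneq (weyl_coef P i) 0; [right|left]. Qed.

(** Fuchs' inequality makes the degrees of the coefficients peak at the top order. *)
Lemma regular_weyl_deg : size (weyl_coef P (diffop_ord P)) = (weyl_deg P).+1.
Proof.
have [i si] := weyl_deg_exists P_reg.1.
apply/eqP; rewrite eqn_leq; apply/andP; split.
  exact: (weyl_deg_leP P (weyl_deg P) (leqnn _)).
case: (regular_size i) si => [le_i si|->]; last by rewrite size_poly0.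
have le_in : (i <= diffop_ord P)%N.
  rewrite /diffop_ord; case: ltnP => //.
  move=> lt_i; move: si; rewrite /weyl_coef nth_default ?size_poly0 //.
  by move: lt_i; case: (size _).
rewrite -si -(leq_add2r (diffop_ord P)).
by apply: leq_trans le_i _; rewrite leq_add2l.
Qed.

(** Regularity bounds the weight $a-b$ of every monomial $x^a\partial^b$ by $\deg
    P-\mathrm{ord}\,P$. *)
Lemma regular_coef_eq0 w b :
  (weyl_deg P < w + diffop_ord P)%N -> (weyl_coef P b)`_(w + b) = 0.
Proof.
move=> ltw; case: (regular_size b) => [|->]; last by rewrite coef0.
rewrite regular_weyl_deg => le_b; apply: nth_default.
rewrite -(leq_add2r (diffop_ord P)); apply: leq_trans le_b _.
by rewrite addnAC leq_add2r.
Qed.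

(** Regularity gives $\deg p_b<\deg P$ for $b<\mathrm{ord}\,P$, so only the leading term of $P$
    reaches the top coefficient, which is therefore a monomial. *)
Lemma ord_laplace_inv_regular :
  diffop_ord (laplace_inv P) = weyl_deg P /\
  exists2 c, c != 0 & weyl_coef (laplace_inv P) (weyl_deg P) = c *: 'X^(diffop_ord P).
Proof.
set N := weyl_deg P; set n := diffop_ord P.
have E i (leNi : (N <= i)%N) :=
  @coef_laplace_inv P N i (introT andP (conj (leqnn N) leNi)).
have pn0 : lead_coef (weyl_coef P n) != 0.
  by rewrite lead_coef_eq0 -size_poly_gt0 regular_weyl_deg.
have EN : weyl_coef (laplace_inv P) N =
    ((-1) ^+ n * lead_coef (weyl_coef P n)) *: 'X^n.
  rewrite E // eqxx mulr1n.
  have ltn_s : (n < size (P : {poly {poly F}}))%N.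
    by rewrite /n /diffop_ord prednK // size_poly_gt0 P_reg.1.
  rewrite (bigD1 (Ordinal ltn_s)) //= big1 => [|b neq_b].
    rewrite addr0 /lead_coef regular_weyl_deg.
    by apply: etrans (congr1 _ (exprN_polyX n)) _; rewrite scalerA mulrC.
  have lt_b : (b < n)%N.
    rewrite ltn_neqAle; apply/andP; split=> //.
    by rewrite /n /diffop_ord -ltnS prednK ?ltn_ord // size_poly_gt0 P_reg.1.
  rewrite nth_default ?scale0r //.
  case: (regular_size b) => [|->]; last by rewrite size_poly0.
  rewrite regular_weyl_deg -/n -/N => le_b.
  rewrite -ltnS -(ltn_add2r n); apply: leq_ltn_trans le_b _.
  by rewrite ltn_add2l.
have c0 : (-1) ^+ n * lead_coef (weyl_coef P n) != 0.
  by rewrite mulf_neq0 // signr_eq0.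
split; last by exists ((-1) ^+ n * lead_coef (weyl_coef P n)).
apply: diffop_ord_eq => [|i ltNi]; last by rewrite [LHS]E 1?ltnW // gtn_eqF.
by rewrite [_`_ _]EN scaler_eq0 (negPf c0) -size_poly_gt0 size_polyXn.
Qed.

End RegularSingular.
End LaplaceCoefficients.

(** * Reduced representative of $\mathrm{Ad}(x^{-\lambda})T$ *)

Section LaurentFractions.
Variable F : fieldType.
Implicit Types (f g : ratfun F) (p h : {poly F}) (P T : weyl F).
Local Notation "p %:F" := (of_poly p) (format "p %:F").
Local Notation X := ('X%:F : ratfun F).

Lemma ratfun_X_neq0 : X != 0.
Proof. by rewrite of_poly_eq0 polyX_eq0. Qed.

(** Clears the pole of a derivative: if $f x^m$ is a polynomial, then so is $f'x^{m+1}$. *)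
Lemma der_mul_expX f m :
  der f * X ^+ m.+1 = X * der (f * X ^+ m) - (f * X ^+ m) *+ m.
Proof.
rewrite derM -!rmorphXn /= [der ('X^m)%:F]ratfun_der_poly derivXn.
rewrite rmorphMn /= exprSr rmorphM /= mulrDr -addrA.
have -> : X * (f * (('X^(m.-1))%:F *+ m)) = (f * ('X^m)%:F) *+ m.
  case: m => [|m]; first by rewrite !mulr0n !mulr0.
  by rewrite !mulrnAr mulrCA -rmorphM -exprS.
by rewrite subrr addr0 mulrA mulrC.
Qed.

(* Laurent polynomials of degree at most $n$. *)
Definition laurent_deg_le (n : nat) f :=
  exists m h, f * X ^+ m = h%:F /\ (size h <= n + m.+1)%N.

Lemma laurent0 n : laurent_deg_le n 0.
Proof. by exists 0%N, 0; rewrite mul0r rmorph0 size_poly0. Qed.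

Lemma laurent_poly n p : (size p <= n.+1)%N -> laurent_deg_le n p%:F.
Proof. by move=> sp; exists 0%N, p; rewrite mulr1 addn1. Qed.

Lemma laurent_divX (c : F) : laurent_deg_le 0 (c%:P%:F / X).
Proof.
exists 1%N, c%:P; rewrite divfK ?ratfun_X_neq0 //.
by split=> //; rewrite (leq_trans (size_polyC_leq1 _)).
Qed.

Lemma laurentD n f g :
  laurent_deg_le n f -> laurent_deg_le n g -> laurent_deg_le n (f + g).
Proof.
move=> [m [h [Eh sh]]] [k [h' [Eh' sh']]].
exists (m + k)%N, (h * 'X^k + h' * 'X^m); split.
  rewrite rmorphD !rmorphM /= -Eh -Eh' !rmorphXn exprD /=; ring.
apply: leq_trans (size_polyD _ _) _; rewrite geq_max; apply/andP; split.
  apply: leq_trans (size_polyMleq _ _) _.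
  by rewrite size_polyXn addnS /= -addSn addnA leq_add2r.
apply: leq_trans (size_polyMleq _ _) _.
by rewrite size_polyXn addnS /= addnC -addnS addnCA leq_add2l.
Qed.

Lemma laurentM n k f g :
  laurent_deg_le n f -> laurent_deg_le k g -> laurent_deg_le (n + k) (f * g).
Proof.
move=> [m [h [Eh sh]]] [r [h' [Eh' sh']]].
exists (m + r)%N, (h * h'); split; first by rewrite rmorphM /= -Eh -Eh' exprD mulrACA.
apply: leq_trans (size_polyMleq _ _) _.
have := leq_add sh sh'; rewrite addnACA addSn !addnS; by case: (_ + _)%N.
Qed.

Lemma laurentN n f : laurent_deg_le n f -> laurent_deg_le n (- f).
Proof.
by move=> [m [h [Eh sh]]]; exists m, (- h); rewrite mulNr Eh rmorphN size_polyN.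
Qed.

Lemma laurent_der n f : laurent_deg_le n f -> laurent_deg_le n (der f).
Proof.
move=> [m [h [Eh sh]]]; exists m.+1, ('X * h^`() - h *+ m); split.
  by rewrite der_mul_expX Eh [der _]ratfun_der_poly rmorphB rmorphM rmorphMn.
apply: leq_trans (size_polyD _ _) _; rewrite size_polyN geq_max; apply/andP; split.
  apply: leq_trans (size_polyMleq _ _) _; rewrite size_polyX /=.
  have [->|h0] := eqVneq h 0; first by rewrite deriv0 size_poly0 addnS.
  by rewrite add1n addnS ltnS (leq_trans _ sh) // ltnW // lt_size_deriv.
rewrite -scaler_nat (leq_trans (size_scale_leq _ _)) //.
by rewrite (leq_trans sh) // leq_add2l leqnSn.
Qed.

Lemma laurent_sum (I : Type) (r : seq I) (C : pred I) n (G : I -> ratfun F) :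
  (forall i, C i -> laurent_deg_le n (G i)) ->
  laurent_deg_le n (\sum_(i <- r | C i) G i).
Proof.
by move=> HG; elim/big_ind: _ => //; [exact: laurent0 | exact: laurentD].
Qed.

Lemma laurent_expD g k i : laurent_deg_le 0 g ->
  laurent_deg_le 0
    ((diffop_D _ - diffop_fun g) ^+ k : {poly ratfun F})`_i.
Proof.
move=> Lg; elim: k i => [|k IHk] i.
  rewrite coefC; case: i => [|i]; last exact: laurent0.
  by apply: (laurent_poly (p := 1)); rewrite size_poly1.
rewrite exprS mulrBl coefB coef_funM diffop_mulD coef_lmulD.
apply: laurentD; last by apply/laurentN/(laurentM (n := 0) (k := 0)).
apply: laurentD; first exact: laurent_der.
by case: eqP => _; [exact: laurent0 | exact: IHk].
Qed.

Lemma coef_weyl_to_frac P i :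
  (weyl_to_frac P : {poly ratfun F})`_i = (weyl_coef P i)%:F.
Proof. by rewrite coef_map. Qed.

(** The powers of $\partial-\lambda/x$ have coefficients of degree at most $0$, so conjugation does
    not raise the degree. *)
Lemma laurent_Ad (lam : F) T i :
  laurent_deg_le (weyl_deg T) (Ad 0 lam (weyl_to_frac T) : {poly ratfun F})`_i.
Proof.
rewrite /Ad /diffop_subst coef_sum; apply: laurent_sum => k _.
rewrite coef_funM coef_weyl_to_frac -(addn0 (weyl_deg T)).
apply: laurentM; first exact/laurent_poly/weyl_deg_leP.
by apply: laurent_expD; rewrite subr0; apply: laurent_divX.
Qed.

(** $(\partial-g)^k$ and $\partial^k$ differ by terms of lower order, so conjugation keeps the
    leading coefficient. *)
Lemma coef_Ad (c lam : F) (S : weylfrac F) i : (diffop_ord S <= i)%N ->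
  (Ad c lam S : {poly ratfun F})`_i = (S : {poly ratfun F})`_i.
Proof.
move=> leSi; rewrite /Ad (@diffop_substE _ _ _ _ i.+1); last first.
  by move: leSi; rewrite /diffop_ord; case: (size _).
rewrite coef_sum big_ord_recr /= big1 ?add0r => [|k _].
  rewrite coef_funM -[_ ^+ i]mulr1 -[1]/(diffop_fun 1).
  by rewrite coef_exp_D_fun // eqxx mulr1n mulr1.
rewrite coef_funM -[_ ^+ k]mulr1 -[1]/(diffop_fun 1) coef_exp_D_fun 1?ltnW //.
by rewrite gtn_eqF // mulr0n mulr0.
Qed.

End LaurentFractions.

(** * Lowering the degree by a left factor $x$ *)

Section ReductionAtZero.
Variable F : fieldType.
Implicit Types (p q h : {poly F}) (P Q T U : weyl F).
Local Notation "p %:F" := (of_poly p) (format "p %:F").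
Local Notation X := ('X%:F : ratfun F).

(** As $\deg q<n$, at most $n-1$ of the $n+m$ factors $x$ divide $q$; the others divide $h$. *)
Lemma dvdp_exp_polyX n m q h :
  q != 0 -> (size q <= n)%N -> 'X^(n + m) %| q * h -> 'X^(m.+1) %| h.
Proof.
move=> q0 sq; have [->|h0] := eqVneq h 0; first by rewrite dvdp0.
rewrite -['X]subr0 -(rmorph0 (@polyC F)) -!mup_geq ?mulf_neq0 // mupM //.
have muq : (mup 0 q < n)%N.
  apply: leq_trans sq; rewrite -(size_exp_XsubC (mup 0 q) (0 : F)) dvdp_leq //.
  by rewrite -mup_geq.
by move=> le_nm; rewrite -(leq_add2l n) addnS (leq_ltn_trans le_nm) // ltn_add2r.
Qed.

Lemma weyl_to_frac_xM U i :
  (weyl_to_frac (weyl_x F * U) : {poly ratfun F})`_i = ('X * weyl_coef U i)%:F.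
Proof. by rewrite coef_weyl_to_frac /weyl_coef coef_funM. Qed.

Lemma weyl_xM_exists (S : weylfrac F) :
    (forall i, exists u : {poly F}, (S : {poly ratfun F})`_i = ('X * u)%:F) ->
  exists U, weyl_to_frac (weyl_x F * U) = S.
Proof.
case/choice => u Eu; exists (\poly_(i < size (S : {poly ratfun F})) u i).
apply/polyP => i; rewrite weyl_to_frac_xM /weyl_coef coef_poly.
by case: ltnP => [_|le_i]; [rewrite Eu | rewrite mulr0 rmorph0 nth_default].
Qed.

(** If the reduced representative $fS$ has degree below $n$, its coefficient $f c x^n$ cannot absorb
    $x^n$, which forces a factor $x$ into every coefficient of $S$. Conversely $S=xU$ makes $U$ a
    multiple of $S$ of degree at most $n-1$. *)
Lemma weyl_deg_redrep_Ad (lam c : F) T n :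
    let S := Ad 0 lam (weyl_to_frac T) in
    (0 < n)%N -> (weyl_deg T <= n)%N -> c != 0 ->
    weyl_coef T (diffop_ord T) = c *: 'X^n ->
  (weyl_deg (redrep S) < n)%N <->
    exists U, weyl_to_frac (weyl_x F * U) = S.
Proof.
move=> S n_gt0 leTn c0 leadT.
have SN : (S : {poly ratfun F})`_(diffop_ord T) = (c *: 'X^n)%:F.
  rewrite coef_Ad ?coef_weyl_to_frac ?leadT //.
  by rewrite /diffop_ord -!subn1 leq_sub2r // size_poly.
have S0 : S != 0.
  apply: contraNneq c0 => S0; move: SN; rewrite S0 coef0 => /esym/eqP.
  by rewrite of_poly_eq0 scaler_eq0 -size_poly_eq0 size_polyXn orbF.
have [Q0 [f Ef] Qmin] := redrepP S0.
have LS i : exists m h, (S : {poly ratfun F})`_i * X ^+ m = h%:F /\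
    (size h <= n + m.+1)%N.
  have [m [h [Eh sh]]] := laurent_Ad lam T i.
  by exists m, h; split=> //; rewrite (leq_trans sh) // leq_add2r.
have EQ i : (weyl_coef (redrep S) i)%:F = f * (S : {poly ratfun F})`_i.
  by rewrite -coef_weyl_to_frac Ef coef_funM.
split=> [ltQn|[U EU]].
  apply: weyl_xM_exists => i; have [m [h [Eh _]]] := LS i.
  set q := weyl_coef (redrep S) (diffop_ord T).
  have q0 : q != 0.
    rewrite -of_poly_eq0 EQ SN mulf_eq0 of_poly_eq0 scaler_eq0 (negPf c0).
    rewrite -size_poly_eq0 size_polyXn /= orbF.
    apply: contra Q0 => /eqP f0; rewrite -weyl_to_frac_eq0 Ef f0.
    by rewrite rmorph0 mul0r.
  have sq : (size q <= n)%N.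
    by rewrite -(ltn_predK ltQn); apply/weyl_deg_leP; rewrite -ltnS (ltn_predK ltQn).
  have : 'X^(m.+1) %| h.
    apply: (@dvdp_exp_polyX n m q) => //.
    (* With $s_i$ the coefficient of $\partial^i$ in $S$, $q=f c x^n$ and $h=s_i x^m$ give $qh=c\,(f
       s_i)\,x^{n+m}$. *)
    apply/dvdpP; exists (c *: weyl_coef (redrep S) i); apply: of_poly_inj.
    rewrite -mul_polyC !rmorphM /= !EQ SN -Eh -mul_polyC !rmorphM /=.
    rewrite !rmorphXn exprD /=; ring.
  case/dvdpP => u Eu; exists u; apply: (mulIf (expf_neq0 m (ratfun_X_neq0 F))).
  by rewrite Eh Eu -rmorphXn -rmorphM exprS /= mulrA [u * _]mulrC.
have U0 : U != 0 by apply: contra_neq S0 => U0; rewrite -EU U0 mulr0 rmorph0.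
have UP : in_ratfun_multiples S U.
  exists X^-1; rewrite -EU rmorphM /= mulrA.
  have -> : weyl_to_frac (weyl_x F) = diffop_fun X.
    by rewrite /weyl_to_frac map_polyC.
  rewrite -diffop_funM.
  have -> : X^-1 * X = 1 by apply: mulVf; exact: ratfun_X_neq0.
  by rewrite rmorph1 mul1r.
apply: leq_ltn_trans (Qmin _ U0 UP) _.
rewrite -(ltn_predK n_gt0) ltnS; apply/weyl_deg_leP => i; rewrite (ltn_predK n_gt0).
have [m [h [Eh sh]]] := LS i; have [->|u0] := eqVneq (weyl_coef U i) 0.
  by rewrite size_poly0.
move: Eh; rewrite -EU weyl_to_frac_xM -rmorphXn -rmorphM => /of_poly_inj Eh.
rewrite -(leq_add2r m.+1); apply: leq_trans sh; rewrite -Eh.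
by rewrite mulrC mulrA -exprSr mulrC size_mulXn // addnC.
Qed.

End ReductionAtZero.

(** * Action on $x^{\lambda}\mathbb C[x]$ and symbols *)

Section ActionOnFractions.
Variable F : numFieldType.
Implicit Types (f g : ratfun F) (p q h : {poly F}) (P Q T U : weyl F).
Local Notation "p %:F" := (of_poly p) (format "p %:F").
Local Notation X := ('X%:F : ratfun F).

Lemma weyl_to_frac_fun p : weyl_to_frac (diffop_fun p) = diffop_fun p%:F.
Proof. by rewrite /weyl_to_frac map_polyC. Qed.

Lemma diffop_act_to_frac U p :
  diffop_act (weyl_to_frac U) p%:F = (diffop_act U p)%:F.
Proof.
by rewrite !diffop_actE -weyl_to_frac_fun -rmorphM /= coef_weyl_to_frac.
Qed.

Lemma sum_ord_support (V : nmodType) (G : nat -> V) m n :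
    (forall i, (m <= i)%N -> G i = 0) -> (forall i, (n <= i)%N -> G i = 0) ->
  \sum_(i < m) G i = \sum_(i < n) G i.
Proof.
move=> G0m G0n.
have E k j : (forall i, (k <= i)%N -> G i = 0) ->
    \sum_(i < k) G i = \sum_(i < k + j) G i.
  move=> G0; rewrite big_split_ord /= [X in _ = _ + X]big1 ?addr0 // => i _.
  by rewrite G0 // leq_addr.
by rewrite (E m n) // (E n m) // addnC.
Qed.

Lemma iter_der_expX i t : iter i der (X ^+ t) = ('X^t)^`(i)%:F.
Proof.
elim: i => [|i IHi]; first by rewrite derivn0 rmorphXn.
by rewrite /= IHi [der _]ratfun_der_poly.
Qed.

Lemma diffop_act_expX (S : weylfrac F) t :
  diffop_act S (X ^+ t) =
  \sum_(i < t.+1) (S : {poly ratfun F})`_i * ('X^t)^`(i)%:F.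
Proof.
transitivity (\sum_(i < size (S : {poly ratfun F}))
    (S : {poly ratfun F})`_i * ('X^t)^`(i)%:F).
  by apply: eq_bigr => i _; rewrite iter_der_expX.
apply: (sum_ord_support
    (G := fun i => (S : {poly ratfun F})`_i * ('X^t)^`(i)%:F)) => i le_i.
  by rewrite nth_default ?mul0r.
rewrite derivn_poly0 ?size_polyXn //; by rewrite rmorph0 mulr0.
Qed.

(* Applying $S$ to $1, x, x^2,\dots$ recovers its coefficients one at a time. *)
Lemma weyl_xM_act (S : weylfrac F) :
  (exists U, weyl_to_frac (weyl_x F * U) = S) <->
  forall t, exists p, diffop_act S (X ^+ t) = ('X * p)%:F.
Proof.
split=> [[U <-] t|HS].
  exists (diffop_act U 'X^t).
  by rewrite -rmorphXn diffop_act_to_frac diffop_actM diffop_act_fun.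
apply: weyl_xM_exists; elim/ltn_ind => t IHt.
have [p] := HS t; rewrite diffop_act_expX big_ord_recr /=.
have [q ->] : exists q, \sum_(i < t) (S : {poly ratfun F})`_i * ('X^t)^`(i)%:F =
    ('X * q)%:F.
  elim/big_ind: _ => [|_ _ [q ->] [q' ->]|i _].
  - by exists 0; rewrite mulr0 rmorph0.
  - by exists (q + q'); rewrite mulrDr rmorphD.
  have [u ->] := IHt i (ltn_ord i); exists (u * ('X^t)^`(i)).
  by rewrite mulrA [RHS]rmorphM.
rewrite derivnXn subnn expr0 ffactnn => /(canRL (addKr _)) E.
(* Solves $xp=xq+t!\,s_t$ for $s_t/x$, where $s_t$ is the coefficient of $\partial^t$; $t!$ is
   invertible in characteristic $0$. *)
exists ((t`!%:R : F)^-1 *: (p - q)).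
have t0 : (t`!%:R : F) != 0 by rewrite pnatr_eq0 -lt0n fact_gt0.
have c0 : (t`!%:R : {poly F})%:F != 0.
  by rewrite of_poly_eq0 -polyC_natr polyC_eq0.
apply: (mulIf c0); rewrite E -rmorphM -rmorphN -rmorphD; congr _%:F.
rewrite -polyC_natr -mulrA [_ * _%:P]mulrC mul_polyC scalerA mulfV // scale1r.
by rewrite mulrBr addrC.
Qed.

(** The scalar in $\partial^b x^s=s(s-1)\cdots(s-b+1)\,x^{s-b}$, for an arbitrary exponent $s$. *)
Definition ffactr (s : F) (b : nat) : F := \prod_(i < b) (s - i%:R).

Lemma ffactrS s b : ffactr s b.+1 = ffactr s b * (s - b%:R).
Proof. by rewrite /ffactr big_ord_recr. Qed.

Lemma ffactrD s a b : ffactr s (a + b) = ffactr s a * ffactr (s - a%:R) b.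
Proof.
rewrite /ffactr big_split_ord /=; congr (_ * _); apply: eq_bigr => i _.
by rewrite natrD opprD addrA.
Qed.

(** Reversing the product and changing all signs relates the exponents $\lambda+t$ on the Laplace
    side to the points $-(\lambda+t)-1$ of the symbol. *)
Lemma ffactrN s b : ffactr (- s - 1) b = (-1) ^+ b * ffactr (s + b%:R) b.
Proof.
rewrite /ffactr [in RHS](reindex_inj rev_ord_inj) /=.
rewrite -[in (-1) ^+ b](card_ord b) -prodr_const -big_split.
apply: eq_bigr => i _ /=; rewrite natrB // -natr1; ring.
Qed.

Section AdAction.
Variable lam : F.
Local Notation y := (Ad 0 (- lam) (diffop_D (ratfun F))).

Lemma act_Ad_D f : diffop_act y f = der f + lam%:P%:F / X * f.
Proof.
rewrite Ad_D diffop_actDl -rmorphN diffop_act_D diffop_act_fun.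
by rewrite subr0 polyCN rmorphN !mulNr opprK.
Qed.

(** Here $y=\partial+\lambda/x=x^{-\lambda}\circ\partial\circ x^{\lambda}$, so this is the formula
    for $\partial^a x^{\lambda+s}$ with $x^\lambda$ removed and denominators cleared. *)
Lemma act_Ad_exp_D a s :
  diffop_act (y ^+ a) (X ^+ s) * X ^+ a =
  (ffactr (lam + s%:R) a)%:P%:F * X ^+ s.
Proof.
elim: a => [|a IHa].
  by rewrite /ffactr big_ord0 rmorph1 !mulr1 mul1r diffop_actE mul1r coefC.
rewrite exprS diffop_actM act_Ad_D mulrDl der_mul_expX IHa.
rewrite [X ^+ a.+1]exprS mulrACA divfK ?ratfun_X_neq0 // IHa ffactrS.
rewrite derM -rmorphXn /= ![der _%:F]ratfun_der_poly derivC rmorph0 mul0r add0r.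
have -> : X * ((ffactr (lam + s%:R) a)%:P%:F * ('X^s)^`()%:F) =
    (ffactr (lam + s%:R) a)%:P%:F * ('X^s)%:F *+ s.
  rewrite derivXn rmorphMn /=; case: s {IHa} => [|s]; first by rewrite !mulr0n !mulr0.
  by rewrite !mulrnAr mulrCA -rmorphM -exprS.
rewrite polyCM rmorphM /= polyCB polyCD !polyC_natr rmorphB rmorphD /=.
rewrite !rmorph_nat.
have E (A : comNzRingType) (u v w : A) :
    u * v *+ s - u * v *+ a + w * (u * v) = u * (w + s%:R - a%:R) * v.
  by rewrite -[u * v *+ s]mulr_natl -[u * v *+ a]mulr_natl; ring.
exact: E.
Qed.

End AdAction.
End ActionOnFractions.

(** * Symbols and the conjugated inverse Laplace transform *)

Section SymbolOfLaplace.
Variable F : numFieldType.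
Implicit Types (s lam : F) (p q h : {poly F}) (P Q T U : weyl F).
Local Notation "p %:F" := (of_poly p) (format "p %:F").
Local Notation X := ('X%:F : ratfun F).

(* The coefficient of $x^{s+w}$ in $P x^s$. *)
Definition symbol P (w : nat) s : F :=
  \sum_(b < size (P : {poly {poly F}})) (weyl_coef P b)`_(w + b) * ffactr s b.

Lemma symbol_eq0 P w s :
  (forall b, (weyl_coef P b)`_(w + b) = 0) -> symbol P w s = 0.
Proof. by move=> P0; rewrite /symbol big1 // => b _; rewrite P0 mul0r. Qed.

Lemma weyl_coef_gt_deg P a b : (weyl_deg P < a)%N -> (weyl_coef P b)`_a = 0.
Proof.
move=> lt_a; have /weyl_deg_leP/(_ b) le_b := leqnn (weyl_deg P).
by rewrite nth_default // (leq_trans le_b).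
Qed.

Lemma ffactr_neq0 s b : ~ is_integer s -> ffactr s b != 0.
Proof.
move=> sN; apply/prodf_neq0 => i _; rewrite subr_eq0.
by apply/eqP => si; apply: sN; exists (Posz i); rewrite si.
Qed.

Section LaplaceAction.
Variables (lam : F) (P : weyl F) (N : nat).
Hypothesis le_degN : (weyl_deg P <= N)%N.
Let S := Ad 0 (- lam) (weyl_to_frac (laplace_inv P)).

(* $x^{N-\lambda}\,\mathcal L^{-1}(P)\,x^{\lambda+t}$ *)
Definition laplace_action (t : nat) : {poly F} :=
  \sum_(b < size (P : {poly {poly F}})) \sum_(a < N.+1)
    ((-1) ^+ b * (weyl_coef P b)`_a * ffactr (lam + (t + b)%:R) a)
      *: 'X^(t + b + (N - a)).

(** $\mathcal L^{-1}$ sends $c\,x^a\partial^b$ to $c\,\partial^a(-x)^b$; the factor $x^N$ with $a\le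
    N$ clears the denominator of $x^{t+b-a}$. *)
Lemma act_Ad_laplace_term c a b t : (a <= N)%N ->
  diffop_act (Ad 0 (- lam) (weyl_to_frac
     (weyl_const c * weyl_D F ^+ a * (- weyl_x F) ^+ b))) (X ^+ t) * X ^+ N =
  (((-1) ^+ b * c * ffactr (lam + (t + b)%:R) a) *: 'X^(t + b + (N - a)))%:F.
Proof.
move=> leaN; set y := Ad 0 (- lam) (diffop_D (ratfun F)).
have actM U V f : diffop_act (Ad 0 (- lam) (weyl_to_frac (U * V))) f =
    diffop_act (Ad 0 (- lam) (weyl_to_frac U))
      (diffop_act (Ad 0 (- lam) (weyl_to_frac V)) f).
  by rewrite -diffop_actM !rmorphM.
have actf p f : diffop_act (Ad 0 (- lam) (weyl_to_frac (diffop_fun p))) f = p%:F * f.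
  by rewrite weyl_to_frac_fun Ad_fun diffop_act_fun.
have xb : (- weyl_x F) ^+ b = weyl_const ((-1) ^+ b) * diffop_fun 'X^b.
  by rewrite rmorphXn rmorphN1 rmorphXn exprNn.
have -> : weyl_const c * weyl_D F ^+ a * (- weyl_x F) ^+ b =
    weyl_const ((-1) ^+ b * c) * weyl_D F ^+ a * diffop_fun 'X^b.
  have -> : weyl_const ((-1) ^+ b * c) = weyl_const ((-1) ^+ b) * weyl_const c.
    exact: rmorphM.
  by rewrite xb mulrA -weyl_constC !mulrA.
rewrite !actM !actf.
have -> : Ad 0 (- lam) (weyl_to_frac (weyl_D F ^+ a)) = y ^+ a.
  by rewrite !rmorphXn; congr (Ad _ _ _ ^+ _); exact: map_polyX.
have -> : ('X^b)%:F * X ^+ t = X ^+ (t + b) by rewrite rmorphXn -exprD addnC.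
have -> : X ^+ N = X ^+ a * X ^+ (N - a) by rewrite -exprD subnKC.
rewrite mulrA -[_ * _ * X ^+ a]mulrA act_Ad_exp_D.
rewrite -mul_polyC [(_ * ffactr _ _)%:P]polyCM [RHS]rmorphM /=.
rewrite [in RHS]rmorphM /= [('X^_)%:F]rmorphXn /= [X ^+ (_ + (N - a))]exprD.
by rewrite !mulrA.
Qed.

Lemma act_Ad_laplace t :
  diffop_act S (X ^+ t) * X ^+ N = (laplace_action t)%:F.
Proof.
have act_sum n (G : 'I_n -> weyl F) f g :
    diffop_act (Ad 0 (- lam) (weyl_to_frac (\sum_i G i))) f * g =
    \sum_i diffop_act (Ad 0 (- lam) (weyl_to_frac (G i))) f * g.
  have -> : Ad 0 (- lam) (weyl_to_frac (\sum_i G i)) =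
      \sum_i Ad 0 (- lam) (weyl_to_frac (G i)) by rewrite !rmorph_sum.
  by rewrite diffop_act_sum big_distrl.
rewrite /S /laplace_inv /diffop_subst act_sum [RHS]rmorph_sum.
apply: eq_bigr => b _.
have sb : (size (weyl_coef P b) <= N.+1)%N by apply/weyl_deg_leP.
have -> : weyl_poly (weyl_D F) (weyl_coef P b) * (- weyl_x F) ^+ b =
    \sum_(a < N.+1)
      weyl_const (weyl_coef P b)`_a * weyl_D F ^+ a * (- weyl_x F) ^+ b.
  by rewrite (weyl_polyE _ sb) big_distrl.
rewrite act_sum [RHS]rmorph_sum.
by apply: eq_bigr => a _; apply: act_Ad_laplace_term; rewrite -ltnS.
Qed.

(** Since $Sx^t$ is [laplace_action t] divided by $x^N$, it lies in $x\mathbb C[x]$ exactly when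
    that polynomial is divisible by $x^{N+1}$. *)
Lemma act_divX t :
  (exists p, diffop_act S (X ^+ t) = ('X * p)%:F) <->
  forall e, (e <= N)%N -> (laplace_action t)`_e = 0.
Proof.
split=> [[p Ep] e leeN|G0].
  have := act_Ad_laplace t; rewrite Ep -rmorphXn -rmorphM => /of_poly_inj <-.
  by rewrite mulrC mulrA -exprSr coefXnM ltnS leeN.
exists (drop_poly N.+1 (laplace_action t)).
apply: (mulIf (expf_neq0 N (ratfun_X_neq0 F))); rewrite act_Ad_laplace.
rewrite -rmorphXn -rmorphM; congr _%:F.
rewrite -{1}(poly_take_drop N.+1 (laplace_action t)).
have -> : take_poly N.+1 (laplace_action t) = 0.
  apply/polyP => e; rewrite coef_take_poly coef0; case: ltnP => //.
  by rewrite ltnS => /G0.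
by rewrite add0r exprS mulrA mulrAC mulrC mulrA.
Qed.

(** The exponent $N+t-w$ selects $a=w+b$. The falling factorial of length $w+b$ at $\lambda+t+b$
    splits into lengths $b$ and $w$; reflecting the first part cancels $(-1)^b$. *)
Lemma coef_laplace_action t w : (w <= N + t)%N ->
  (laplace_action t)`_(N + t - w) =
  ffactr (lam + t%:R) w * symbol P w (- (lam + t%:R) - 1).
Proof.
move=> lew; rewrite /laplace_action coef_sum mulr_sumr; apply: eq_bigr => b _.
rewrite coef_sum.
have E (a : 'I_N.+1) : (N + t - w == t + b + (N - a))%N = (a == w + b :> nat)%N.
  have leaN : (a <= N)%N by rewrite -ltnS.
  rewrite -(eqn_add2r (w + a)) -(eqn_add2r 0); apply/eqP/eqP; lia.
(* For $w+b>N$ no $a\le N$ matches, and $x^{w+b}$ is absent from the coefficient of $\partial^b$. *)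
have [leN|ltN] := leqP (w + b) N; last first.
  rewrite weyl_coef_gt_deg ?(leq_ltn_trans le_degN) // mul0r mulr0 big1 // => a _.
  rewrite coefZ coefXn E ltn_eqF ?mulr0 //.
  by rewrite (leq_trans _ ltN).
have ltN : (w + b < N.+1)%N by [].
rewrite (bigD1 (Ordinal ltN)) //= big1 ?addr0 => [|a neq_a]; last first.
  by rewrite coefZ coefXn E (_ : (_ == _) = false) ?mulr0 //; apply/negbTE.
rewrite coefZ coefXn (E (Ordinal ltN)) eqxx mulr1.
rewrite ffactrN [(w + b)%N]addnC ffactrD natrD addrA addrK; ring.
Qed.

(** The exponents $N+t-w\le N$ are those with $t\le w$, and for $\lambda\notin\mathbb Z$ the factor
    in front of the symbol is nonzero. For $w>N+t$ the symbol vanishes by degree. *)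
Lemma weyl_xM_Ad_laplace : ~ is_integer lam ->
  (exists U, weyl_to_frac (weyl_x F * U) = S) <->
  forall t w, (t <= w)%N -> symbol P w (- (lam + t%:R) - 1) = 0.
Proof.
move=> lamN.
have f0 t w : ffactr (lam + t%:R) w != 0.
  apply: ffactr_neq0 => -[z Ez]; apply: lamN; exists (z - t%:Z).
  by rewrite rmorphB /= -Ez addrK.
rewrite weyl_xM_act; split=> [HS t w letw|sym0 t].
  have [lew|ltw] := leqP w (N + t); last first.
    apply: symbol_eq0 => b; apply: weyl_coef_gt_deg.
    apply: leq_ltn_trans le_degN _; apply: leq_trans (leq_addr b w).
    exact: leq_trans (leq_addr t N.+1) ltw.
  have /act_divX/(_ (N + t - w)%N) G0 := HS t.
  apply: (mulfI (f0 t w)); rewrite mulr0 -coef_laplace_action // G0 //.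
  by rewrite leq_subLR addnC leq_add2r.
apply/act_divX => e leeN.
have lee : (e <= N + t)%N by rewrite (leq_trans leeN) // leq_addr.
rewrite -(subKn lee) coef_laplace_action ?leq_subr // sym0 ?mulr0 //.
by rewrite leq_subRL // leq_add2r.
Qed.

End LaplaceAction.
End SymbolOfLaplace.

(** * Exponents of the reduced representative *)

Section ReducedRepresentative.
Variable F : fieldType.
Implicit Types (f p q : {poly F}) (P Q : weyl F).
Local Notation "p %:F" := (of_poly p) (format "p %:F").

(* If the reduced representative is $(a/b)P$ in lowest terms, $a$ divides it, so
   that $a$ is constant by minimality of the degree. *)
Lemma redrep_factor P : P != 0 ->
  exists2 f, f != 0 & P = diffop_fun f * redrep (weyl_to_frac P).
Proof.
move=> P0; have := P0; rewrite -weyl_to_frac_eq0.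
case/redrepP; move: (redrep (weyl_to_frac P)) => Q Q0 [phi EQ] Qmin.
have phi0 : phi != 0.
  apply: contraNneq Q0 => phi0; rewrite -weyl_to_frac_eq0 EQ phi0.
  by rewrite rmorph0 mul0r.
have [a [b [b0 Ephi]]] : exists a b, b != 0 /\ phi * b%:F = a%:F.
  exists (ratfun_num phi), (ratfun_den phi).
  move: (ratfun_den_neq0 phi) (ratfun_numden phi).
  move: (ratfun_num phi) (ratfun_den phi) => a b b0 E; split=> //.
  by rewrite E; apply: divfK; rewrite of_poly_eq0.
have a0 : a != 0.
  by rewrite -of_poly_eq0 -Ephi; apply: mulf_neq0; rewrite ?of_poly_eq0 //; exact: phi0.
have Eab i : weyl_coef Q i * b = a * weyl_coef P i.
  apply: of_poly_inj; rewrite !rmorphM /= -coef_weyl_to_frac EQ coef_funM.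
  by rewrite coef_weyl_to_frac mulrAC Ephi.
set g := gcdp a b; have g0 : g != 0 by rewrite gcdp_eq0 (negPf a0).
have Ea : a = (a %/ g) * g by rewrite divpK // dvdp_gcdl.
have Eb : b = (b %/ g) * g by rewrite divpK // dvdp_gcdr.
have cop : coprimep (a %/ g) (b %/ g) by apply: coprimep_div_gcd; rewrite a0.
move: (a %/ g) (b %/ g) Ea Eb cop => a1 b1 Ea Eb cop.
have E1 i : weyl_coef Q i * b1 = a1 * weyl_coef P i.
  by apply: (mulIf g0); rewrite -mulrA -Eb Eab Ea mulrAC.
have a10 : a1 != 0 by apply: contra_neq a0 => a10; rewrite Ea a10 mul0r.
have b10 : b1 != 0 by apply: contra_neq b0 => b10; rewrite Eb b10 mul0r.
have dvda i : a1 %| weyl_coef Q i.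
  by rewrite -(Gauss_dvdpl _ cop) E1 dvdp_mulr.
pose Q1 : weyl F := \poly_(i < size (Q : {poly {poly F}})) (weyl_coef Q i %/ a1).
have EQ1 : Q = diffop_fun a1 * Q1.
  apply/polyP => i; rewrite coef_funM coef_poly; case: ltnP => [_|le_i].
    by rewrite mulrC divpK.
  by rewrite nth_default // mulr0.
have Q10 : Q1 != 0 by apply: contra_neq Q0 => Q10; rewrite EQ1 Q10 mulr0.
have Q1P : in_ratfun_multiples (weyl_to_frac P) Q1.
  have E : weyl_to_frac Q = diffop_fun a1%:F * weyl_to_frac Q1.
    rewrite EQ1.
    have <- : weyl_to_frac (diffop_fun a1) = diffop_fun a1%:F by exact: map_polyC.
    exact: rmorphM.
  have Va : a1%:F^-1 * a1%:F = 1 by apply: mulVf; rewrite of_poly_eq0.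
  exists (a1%:F^-1 * phi).
  transitivity (diffop_fun (a1%:F^-1) * weyl_to_frac Q).
    by rewrite E mulrA -diffop_funM Va rmorph1 mul1r.
  by rewrite EQ diffop_funM mulrA.
have sa1 : size a1 = 1%N.
  have [i si] := weyl_deg_exists Q10.
  have /weyl_deg_leP/(_ i) := leqnn (weyl_deg Q).
  rewrite {1}EQ1 /weyl_coef coef_funM size_mul //; last first.
    by rewrite -size_poly_eq0 si.
  rewrite -/(weyl_coef Q1 i) si addnS /= => le1.
  have := leq_trans le1 (Qmin _ Q10 Q1P : (weyl_deg Q < (weyl_deg Q1).+1)%N).
  rewrite -[X in (_ <= X)%N]add1n leq_add2r => le11.
  by apply/eqP; rewrite eqn_leq le11 size_poly_gt0.
have [c c0 Ea1] := size_poly1P _ (introT eqP sa1).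
(* As $a_1=c$ is constant, $b_1Q=cP$ becomes $P=(b_1/c)Q$. *)
exists (c^-1 *: b1); first by rewrite scaler_eq0 invr_eq0 (negPf c0).
apply/polyP => i; rewrite coef_funM -/(weyl_coef P i) -/(weyl_coef Q i).
rewrite -scalerAl mulrC E1 Ea1 mul_polyC scalerA mulVf // scale1r //.
Qed.

Section Multiple.
Variables (f : {poly F}) (P Q : weyl F).
Hypotheses (f0 : f != 0) (PE : P = diffop_fun f * Q).

Lemma weyl_coef_multiple i : weyl_coef P i = f * weyl_coef Q i.
Proof. by rewrite PE /weyl_coef coef_funM. Qed.

Lemma ord_multiple : diffop_ord P = diffop_ord Q.
Proof. by rewrite /diffop_ord PE diffop_mulfn size_scale. Qed.

(** A left factor $f$ raises the degrees of all nonzero coefficients by $\deg f$, which cancels in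
    Fuchs' inequality. *)
Lemma regular_multiple : regular_singular_infty P -> regular_singular_infty Q.
Proof.
move=> [P0 Preg]; have Q0 : Q != 0.
  by apply: contra_neq P0 => Q0; rewrite PE Q0 mulr0.
split=> // i qi0; have := Preg i; rewrite ord_multiple !weyl_coef_multiple.
rewrite mulf_neq0 // => /(_ isT).
have qn0 : weyl_coef Q (diffop_ord Q) != 0 by rewrite -lead_coef_eq0 in Q0.
rewrite !size_mul //; move: f0; rewrite -size_poly_gt0.
by case: (size f) => // d _; rewrite !addSn /= -!addnA leq_add2l.
Qed.

Lemma deg_multiple : regular_singular_infty P ->
  weyl_deg P = ((size f).-1 + weyl_deg Q)%N.
Proof.
move=> Preg; have Qreg := regular_multiple Preg.
have := regular_weyl_deg Preg; rewrite ord_multiple weyl_coef_multiple.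
have := regular_weyl_deg Qreg; have := f0; rewrite -size_poly_gt0 => sf sq.
rewrite size_mul //; last by rewrite -size_poly_eq0 sq.
by rewrite sq; case: (size f) sf => // d _; rewrite addSn addnS => -[].
Qed.

End Multiple.
End ReducedRepresentative.

(** * Exponents at infinity in terms of symbols *)

Section ExponentsAtInfinity.
Variable F : numFieldType.
Implicit Types (s : F) (f p q : {poly F}) (P Q : weyl F).

Lemma pochhammer_ffactr s k i : (i <= k)%N ->
  pochhammer (s - k%:R + i%:R + 1) (k - i) = ffactr s (k - i).
Proof.
move=> leik; rewrite /pochhammer /ffactr (reindex_inj rev_ord_inj) /=.
apply: eq_bigr => j _.
have {1}<- : (k - i - j.+1 + j.+1 + i)%N = k by rewrite subnK ?ltn_ord ?subnK.
rewrite !natrD -[j.+1]addn1 natrD; ring.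
Qed.

Lemma weyl_coef_gt_ord P b : (diffop_ord P < b)%N -> weyl_coef P b = 0.
Proof.
move=> lt_b; rewrite /weyl_coef nth_default //.
by move: lt_b; rewrite /diffop_ord; case: (size _).
Qed.

(** $P_i^{(k-i)}(0)/(k-i)!$ is the coefficient of $x^{\deg P-i}\partial^{k-i}$. With $b=k-i$ this
    monomial is $x^{w+b}\partial^b$, and the rising factorial is the falling one at $s$. *)
Lemma infty_poly_symbol P w k s : (w + k = weyl_deg P)%N ->
  (diffop_ord P <= k)%N -> (infty_poly P k (s - k%:R)).[0] = symbol P w s.
Proof.
move=> wk lek; rewrite /infty_poly horner_sum (reindex_inj rev_ord_inj) /=.
transitivity (\sum_(b < k.+1) (weyl_coef P b)`_(w + b) * ffactr s b).
  apply: eq_bigr => b _; have leb : (b <= k)%N by rewrite -ltnS.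
  rewrite subSS pochhammer_ffactr ?leq_subr // subKn // hornerZ horner_coef0.
  rewrite coef_derivn addn0 ffactnn /infty_coef -wk.
  rewrite (leq_trans (leq_subr _ _) (leq_addl _ _)) coef_poly.
  have -> : (w + k - (k - b) = w + b)%N by rewrite subnBA // addnAC addnK.
  have -> : (if (b < (diffop_ord P).+1)%N then (weyl_coef P b)`_(w + b) else 0)
      = (weyl_coef P b)`_(w + b).
    by case: ltnP => // lt_b; rewrite weyl_coef_gt_ord ?coef0.
  rewrite -[(weyl_coef P b)`_(w + b) *+ _]mulr_natr mulrCA divfK; first by rewrite mulrC.
  by rewrite pnatr_eq0 -lt0n fact_gt0.
apply: (sum_ord_support (G := fun b => (weyl_coef P b)`_(w + b) * ffactr s b)) => b le_b.
  by rewrite weyl_coef_gt_ord ?coef0 ?mul0r // (leq_ltn_trans lek).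
by rewrite /weyl_coef (nth_default 0 le_b) coef0 mul0r.
Qed.

(** The condition $p_k(-\mu_i-t-k,0)=0$ for $k=\mathrm{ord}\,P+j$, read at weight $w=\deg P-k$. *)
Lemma symbol_exponents P l (mu : 'I_l -> F) (n : 'I_l -> nat) i w j t :
    semisimple_exponents_infty P mu n ->
    (\sum_(i < l) n i)%N = diffop_ord P ->
    (w + j + diffop_ord P = weyl_deg P)%N -> (j + t < n i)%N ->
  symbol P w (- mu i - t%:R) = 0.
Proof.
move=> [_ _ Pexp] sum_n wj jt.
have E : (w + (j + diffop_ord P) = weyl_deg P)%N by rewrite addnA.
rewrite -(infty_poly_symbol _ E) ?leq_addl //; apply: Pexp; rewrite ?sum_n.
- by apply: leq_ltn_trans jt; rewrite leq_addl.
- exact: leq_addl.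
by rewrite addnAC addnC ltn_add2l.
Qed.

(** $Px^s=f(x)\,(Qx^s)$, and the term $f_e x^e$ raises the weight by $e$. *)
Lemma symbol_multiple f P Q w s : P = diffop_fun f * Q -> f != 0 ->
  symbol P (w + (size f).-1) s =
  \sum_(e < size f) f`_e * symbol Q (w + ((size f).-1 - e)) s.
Proof.
move=> PE f0; have sf : (size f).-1.+1 = size f by rewrite prednK ?size_poly_gt0.
have sPQ : size (P : {poly {poly F}}) = size (Q : {poly {poly F}}).
  by rewrite PE diffop_mulfn size_scale.
under [RHS]eq_bigr do rewrite mulr_sumr.
rewrite [RHS]exchange_big /symbol sPQ /=; apply: eq_bigr => b _.
rewrite (weyl_coef_multiple PE) coefM mulr_suml.
pose G e := f`_e * (weyl_coef Q b)`_(w + (size f).-1 + b - e) * ffactr s b.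
transitivity (\sum_(e < size f) G e).
  apply: (sum_ord_support (G := G)) => e le_e; rewrite /G nth_default ?mul0r //.
  by rewrite -sf; apply: leq_trans le_e; rewrite ltnS addnAC leq_addl.
apply: eq_bigr => e _; rewrite /G mulrA; congr (_ * _`_ _ * _).
have led : (e <= (size f).-1)%N by rewrite -ltnS sf.
by rewrite [RHS]addnAC [(w + _ + b)%N]addnAC addnBA.
Qed.

Section Symbols.
Variables (f : {poly F}) (P Q : weyl F).
Hypotheses (PE : P = diffop_fun f * Q) (f0 : f != 0).
Hypothesis P_reg : regular_singular_infty P.

(* Downward induction on the weight [w]: the leading coefficient of [f] makes
   the relations between the symbols of [P] and [Q] triangular. *)
Lemma symbol_multiple_eq0 s m :
    (forall w j, (w + j + diffop_ord P = weyl_deg P)%N -> (j < m)%N ->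
      symbol P w s = 0) ->
  forall w j, (w + j + diffop_ord Q = weyl_deg Q)%N -> (j < m)%N ->
    symbol Q w s = 0.
Proof.
move=> P0 w j; elim/ltn_ind: j w => j IHj w wj ltjm.
have Q_reg := regular_multiple f0 PE P_reg.
have sf : (size f).-1.+1 = size f by rewrite prednK ?size_poly_gt0.
have := symbol_multiple w s PE f0; rewrite (P0 _ j) //; last first.
  rewrite (deg_multiple f0 PE P_reg) (ord_multiple f0 PE) -wj.
  by rewrite -!addnA [RHS]addnCA.
rewrite -sf big_ord_recr /= subnn addn0 big1 ?add0r => [/esym/eqP|e _].
  by rewrite mulf_eq0 -[_`_ _]/(lead_coef f) lead_coef_eq0 (negPf f0) => /eqP.
have := subn_gt0 e (size f).-1; rewrite ltn_ord; move: (_ - _)%N => d d_gt0.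
(* For $d\le j$ the symbol of weight $w+d$ vanishes by induction; for $d>j$ this weight exceeds
   $\deg Q-\mathrm{ord}\,Q$ and regularity applies. *)
have [ledj|ltjd] := leqP d j.
  rewrite (IHj (j - d)%N) ?mulr0 //.
  - by rewrite ltn_subrL d_gt0 (leq_trans d_gt0).
  - by rewrite -(addnA w d) subnKC.
  by rewrite (leq_ltn_trans (leq_subr _ _)).
rewrite symbol_eq0 ?mulr0 // => b; apply: regular_coef_eq0 => //.
by rewrite -wj ltn_add2r ltn_add2l.
Qed.

End Symbols.

(** * The indicial polynomial at infinity *)

Section RegularSymbol.
Variables (P : weyl F) (l : nat) (mu : 'I_l -> F) (n : 'I_l -> nat).
Hypothesis P_reg : regular_singular_infty P.
Hypothesis sum_n : (\sum_(i < l) n i)%N = diffop_ord P.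
Hypothesis mu_sub_nint : forall i j, i <> j -> ~ is_integer (mu i - mu j).
Hypothesis sym0 : forall i w j t, (w + j + diffop_ord P = weyl_deg P)%N ->
  (j + t < n i)%N -> symbol P w (- mu i - t%:R) = 0.

Definition ffactr_poly (b : nat) : {poly F} := \prod_(i < b) ('X - i%:R%:P).

Lemma horner_ffactr_poly b s : (ffactr_poly b).[s] = ffactr s b.
Proof. by rewrite horner_prod; apply: eq_bigr => i _; rewrite hornerXsubC. Qed.

Lemma size_ffactr_poly b : size (ffactr_poly b) = b.+1.
Proof. by rewrite size_prod_XsubC /index_enum -enumT size_enum_ord. Qed.

(* The indicial polynomial has degree [diffop_ord P], hence no root besides the
   exponents. *)
Lemma indicial_not_root i : (diffop_ord P <= weyl_deg P)%N ->
  symbol P (weyl_deg P - diffop_ord P) (- mu i - (n i)%:R) != 0.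
Proof.
move=> le_nN; set w := (_ - _)%N; set N := diffop_ord P.
have sP : size (P : {poly {poly F}}) = N.+1.
  by rewrite /N /diffop_ord prednK // size_poly_gt0 P_reg.1.
(* The symbol of top weight as a polynomial in $s$; its leading coefficient is that of the top
   coefficient of $P$. *)
pose r := \sum_(b < N.+1) (weyl_coef P b)`_(w + b) *: ffactr_poly b.
have rE s : r.[s] = symbol P w s.
  rewrite /symbol sP horner_sum; apply: eq_bigr => b _.
  by rewrite hornerZ horner_ffactr_poly.
have wN : (w + N = weyl_deg P)%N by rewrite subnK.
have r0 : r`_N != 0.
  rewrite coef_sum big_ord_recr /= big1 ?add0r => [|b _]; last first.
    by rewrite coefZ [(ffactr_poly b)`_N]nth_default ?mulr0 // size_ffactr_poly.
  have monic_b : ffactr_poly N \is monic by apply: monic_prod_XsubC.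
  have -> : ((weyl_coef P N)`_(w + N) *: ffactr_poly N)`_N = lead_coef (weyl_coef P N).
    rewrite coefZ; have := monicP monic_b; rewrite /lead_coef size_ffactr_poly /= => ->.
    by rewrite mulr1 wN regular_weyl_deg.
  by rewrite lead_coef_eq0 -size_poly_gt0 regular_weyl_deg.
have sr : (size r <= N.+1)%N.
  apply: (leq_trans (size_sum _ _ _)); apply/bigmax_leqP => b _.
  by rewrite (leq_trans (size_scale_leq _ _)) // size_ffactr_poly.
apply: contraNneq r0; rewrite -rE => ri0.
(* One more than $\mathrm{ord}\,P$ candidate roots, distinct because $\mu_k-\mu_{k'}\notin\mathbb Z$
   for $k\ne k'$. *)
pose rs := (- mu i - (n i)%:R) ::
  [seq - mu k - t%:R | k <- enum 'I_l, t <- iota 0 (n k)].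
have inj k t k' t' : - mu k - t%:R = - mu k' - t'%:R -> k = k' /\ t = t'.
  move=> E; have [ekk'|/eqP nkk'] := eqVneq k k'.
    split=> //; move: E; rewrite ekk' => /addrI/oppr_inj/eqP.
    by rewrite eqr_nat => /eqP.
  case: (mu_sub_nint nkk'); exists (t'%:Z - t%:Z).
  rewrite rmorphB /=; apply/eqP; rewrite subr_eq; apply/eqP.
  apply: oppr_inj; rewrite opprD addrC; move/eqP: E.
  rewrite subr_eq => /eqP ->; ring.
have -> : r = 0; last by rewrite coef0.
apply: (@roots_geq_poly_eq0 _ r rs).
- rewrite /= /root ri0 eqxx /=; apply/allP => s /allpairsPdep[k [t [_]]].
  rewrite mem_iota add0n /= => ltt ->; rewrite /root rE.
  by rewrite (@sym0 k w 0 t) // addn0.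
- rewrite /= ; apply/andP; split.
    apply/negP => /allpairsPdep[k [t [_]]]; rewrite mem_iota add0n /= => ltt.
    by case/inj => ki nt; rewrite -ki -nt ltnn in ltt.
  apply: allpairs_uniq_dep.
  - exact: enum_uniq.
  - by move=> k _; exact: iota_uniq.
  by move=> [k t] [k' t'] _ _ /= /inj [-> ->].
apply: leq_trans sr _; rewrite /= ltnS size_allpairs_dep.
rewrite sumnE big_map big_enum /= /N -sum_n.
by apply: eq_leq; apply: eq_bigr => k _; rewrite size_iota.
Qed.

Lemma symbol_eq0_iff i : (0 < n i)%N ->
  (forall t w, (t <= w)%N -> symbol P w (- mu i - t%:R) = 0) <->
  (weyl_deg P < n i + diffop_ord P)%N.
Proof.
move=> ni_gt0; split=> [sym00|ltn t w letw].
  rewrite ltnNge; apply/negP => le_deg.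
  have le_nN : (diffop_ord P <= weyl_deg P)%N by apply: leq_trans le_deg; rewrite leq_addl.
  (* The choice $t=n_i$, $w=\deg P-\mathrm{ord}\,P$ satisfies $t\le w$ here. *)
  by move/eqP: (indicial_not_root i le_nN); apply; rewrite sym00 // leq_subRL // addnC.
have [leN|ltN] := leqP (w + diffop_ord P) (weyl_deg P); last first.
  by apply: symbol_eq0 => b; apply: regular_coef_eq0.
(* With $j=\deg P-\mathrm{ord}\,P-w$, $t\le w$ gives $j+t\le\deg P-\mathrm{ord}\,P<n_i$. *)
apply: (@sym0 i w (weyl_deg P - (w + diffop_ord P)) t).
  by rewrite addnAC subnKC.
lia.
Qed.

End RegularSymbol.

End ExponentsAtInfinity.

(** * Order of the Euler transform *)

Section EulerTransform.
Variable F : numFieldType.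
Implicit Types (lam : F) (P Q T : weyl F).

Lemma Ad_neq0 (c lam : F) (S : weylfrac F) : S != 0 -> Ad c lam S != 0.
Proof.
rewrite -lead_coef_eq0; apply: contra_neq => S0.
by rewrite /lead_coef -(coef_Ad c lam) // S0 coef0.
Qed.

(** $\mathcal L$ turns the degree of a nonzero operator into the order of its image, and conjugation
    keeps operators nonzero. *)
Lemma ord_euler0 lam P : P != 0 ->
  diffop_ord (euler0 lam (weyl_to_frac P)) =
  weyl_deg (redrep (Ad 0 (- lam)
    (weyl_to_frac (laplace_inv (redrep (weyl_to_frac P)))))).
Proof.
rewrite -weyl_to_frac_eq0 => /redrepP[Q0 _ _]; rewrite /euler0 /RAd ord_laplace //.
have /redrepP[] // : Ad 0 (- lam)
    (weyl_to_frac (laplace_inv (redrep (weyl_to_frac P)))) != 0.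
apply: Ad_neq0; rewrite weyl_to_frac_eq0 raddf_eq0 //.
exact: can_inj (@laplace_invK F).
Qed.

Lemma ord_euler0_lt lam Q : regular_singular_infty Q -> (0 < diffop_ord Q)%N ->
    ~ is_integer lam ->
  (weyl_deg (redrep (Ad 0 (- lam) (weyl_to_frac (laplace_inv Q)))) <
     diffop_ord Q)%N <->
  forall t w, (t <= w)%N -> symbol Q w (- (lam + t%:R) - 1) = 0.
Proof.
move=> Q_reg n_gt0 lamN; rewrite -(weyl_xM_Ad_laplace (leqnn _) lamN).
have [ordT [c c0 leadT]] := ord_laplace_inv_regular Q_reg.
apply: (weyl_deg_redrep_Ad _ n_gt0 _ c0); rewrite ?ordT //.
by rewrite weyl_deg_laplace_inv // Q_reg.1.
Qed.

(** The exponents are given for $P=fQ$, whereas the Euler transform is computed from the reduced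
    representative $Q$; the vanishing of symbols is first carried over to $Q$. *)
Lemma ord_euler0_exponent P l (mu : 'I_l -> F) (n : 'I_l -> nat) :
    (forall i, (0 < n i)%N) -> regular_singular_infty P ->
    semisimple_exponents_infty P mu n ->
    (\sum_(i < l) n i)%N = diffop_ord P ->
    (forall i, ~ is_integer (mu i)) ->
    (forall i j, i <> j -> ~ is_integer (mu i - mu j)) ->
  forall i,
    (diffop_ord (euler0 (mu i - 1) (weyl_to_frac P)) < diffop_ord P)%N <->
    (weyl_deg (redrep (weyl_to_frac P)) < n i + diffop_ord P)%N.
Proof.
move=> n_gt0 P_reg P_exp sum_n mu_nint mu_sub_nint i.
have [f f0 PE] := redrep_factor P_reg.1; rewrite ord_euler0 ?P_reg.1 //.
move: (redrep _) PE => Q PE.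
have Q_reg := regular_multiple f0 PE P_reg.
have lamN : ~ is_integer (mu i - 1).
  by case=> z Ez; apply: (mu_nint i); exists (z + 1); rewrite intrD -Ez subrK.
have n0 : (0 < diffop_ord Q)%N.
  by rewrite -(ord_multiple f0 PE) -sum_n (bigD1 i) //= ltn_addr.
have sym0 k w j t : (w + j + diffop_ord Q = weyl_deg Q)%N ->
    (j + t < n k)%N -> symbol Q w (- mu k - t%:R) = 0.
  move=> wj jt.
  (* For fixed $t$ the condition $j+t<n_k$ is the bound $j<n_k-t$ required by the induction on
     weights. *)
  apply: (symbol_multiple_eq0 PE f0 P_reg (m := n k - t) _ wj); last by rewrite ltn_subRL addnC.
  move=> w' j' wj'; rewrite ltn_subRL addnC => jt'.
  exact: symbol_exponents P_exp sum_n wj' jt'.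
rewrite (ord_multiple f0 PE) ord_euler0_lt //.
rewrite -(symbol_eq0_iff Q_reg _ mu_sub_nint sym0) //; last first.
  by rewrite -(ord_multiple f0 PE).
have E (t : nat) : - (mu i - 1 + t%:R) - 1 = - mu i - t%:R by ring.
by split=> H t w /H; rewrite E.
Qed.

End EulerTransform.

Unset Implicit Arguments.
Set Strict Implicit.

Theorem theorem1p4 (R : realType) (l : nat) (mu : 'I_l -> R[i])
    (n : 'I_l -> nat) (P : weyl R[i])
    (n_gt0 : forall i, (0 < n i)%N)
    (P_reg : regular_singular_infty P)
    (P_exp : semisimple_exponents_infty P mu n)
    (sum_n : (\sum_(i < l) n i)%N = diffop_ord P)
    (mu_nint : forall i, ~ is_integer (mu i))
    (mu_sub_nint : forall i j, i <> j -> ~ is_integer (mu i - mu j)) :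
  forall i : 'I_l,
    (diffop_ord (euler0 (mu i - 1) (weyl_to_frac P)) < diffop_ord P)%N <->
    (weyl_deg (redrep (weyl_to_frac P)))%:Z - (diffop_ord P)%:Z < (n i)%:Z.
Proof.
(* The difference may be negative, hence the integers; moving the order to the right returns to
   natural numbers. *)
move=> i; rewrite ltrBlDr -PoszD ltz_nat.
exact: ord_euler0_exponent n_gt0 P_reg P_exp sum_n mu_nint mu_sub_nint i.
Qed.
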